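(* Fix an integer $k\ge 1$ and $l\in\{0,\dots,k\}$. The map $$\bigsqcup_{n=0}^\infty\ \bigsqcup_{(p_n,\dots,p_1)\in\mathcal P^k_{res,n}(0,l)} B(p_n,\dots,p_1)\ \longrightarrow\ B(\lambda_l)\otimes B(\lambda_0)^\ast=\mathcal P^{(l,0)}$$ given by $1\mapsto[[\ ]]=b_{\lambda_0}\otimes b_{-\lambda_0}$ (for $n=0$, which occurs only if $l=0$) and $$\varphi^{\ast p_n}_{j_n}\cdots\varphi^{\ast p_1}_{j_1}\ \longmapsto\ [[j_n-p_n,\dots,j_1-p_1]]\qquad(n\ge1,\ \varphi^{\ast p_n}_{j_n}\cdots\varphi^{\ast p_1}_{j_1}\in B(p_n,\dots,p_1)),$$ where the path on the right has region sequence $(m_n,\dots,m_0)$ with $m_s=(-1)^{p_1}+\cdots+(-1)^{p_s}$, is an isomorphism of affine crystals; that is, it is a bijection commuting with $\tilde e_i,\tilde f_i$ $(i=0,1)$ and preserving the weights (in $P$, including the $\delta$-part).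
   Context: **Weights.** $P=\mathbb Z\Lambda_0\oplus\mathbb Z\Lambda_1\oplus\mathbb Z\delta$ is the weight lattice of $\widehat{sl_2}$, $\alpha_1=2\Lambda_1-2\Lambda_0$, $\alpha_0=\delta-\alpha_1$, $\lambda_l=(k-l)\Lambda_0+l\Lambda_1$. $B(\lambda)$ is the crystal of the integrable highest weight $U_q(\widehat{sl_2})$-module $V(\lambda)$ with highest weight element $b_\lambda$; $B(\lambda)^\ast$ is the dual (lowest weight) crystal with lowest weight element $b_{-\lambda}$. **Creation algebra.** $H(0,0)=H(0,1)=H(1,1)=0$, $H(1,0)=1$, $K=1-H$; $\epsilon(j)=0$ for $j$ even, $1$ for $j$ odd. $\mathcal A$ is the associative unital $\mathbb Z$-algebra with generators $\varphi^{\ast p}_j$ ($j\in\mathbb Z$, $p\in\{0,1\}$) and relations $$\varphi^{\ast p_2}_{j_2}\varphi^{\ast p_1}_{j_1}+\varphi^{\ast p_2}_{j_1-2K(p_2,p_1)+\epsilon(j_1+j_2)}\varphi^{\ast p_1}_{j_2+2K(p_2,p_1)-\epsilon(j_1+j_2)}=0,$$ where, if the two monomials coincide, the relation is read as: that monomial is $0$. For $(p_n,\dots,p_1)\in\{0,1\}^n$, $B(p_n,\dots,p_1)$ is the set of monomials $\varphi^{\ast p_n}_{j_n}\cdots\varphi^{\ast p_1}_{j_1}$ with $j_{r+1}-j_r\ge 2H(p_{r+1},p_r)$ for $1\le r\le n-1$ (normal monomials). For $n=0$, $B(\emptyset)=\{1\}$. Every monomial in the generators with upper indices $(p_n,\dots,p_1)$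 is $0$ or $\pm$ a unique element of $B(p_n,\dots,p_1)$. **Crystal structure on $B(p_n,\dots,p_1)$.** The weight of a monomial is the sum of the weights $wt(\varphi^{\ast p}_j)=-\lfloor j/2\rfloor\delta+(1-2\epsilon(j))(\Lambda_1-\Lambda_0)$; $wt(1)=0$. On $B(p)=\{\varphi^{\ast p}_j\}$: $\tilde f_1\varphi^{\ast p}_{2j}=\varphi^{\ast p}_{2j+1}$, $\tilde f_0\varphi^{\ast p}_{2j-1}=\varphi^{\ast p}_{2j}$, $\tilde e_1\varphi^{\ast p}_{2j+1}=\varphi^{\ast p}_{2j}$, $\tilde e_0\varphi^{\ast p}_{2j}=\varphi^{\ast p}_{2j-1}$, all other actions being $0$. Tensor products of crystals use the rule (with $\varepsilon_i(b)=\max\{m:\tilde e_i^mb\ne0\}$, $\phi_i(b)=\max\{m:\tilde f_i^mb\neq0\}$): $\tilde f_i(b\otimes b')=\tilde f_ib\otimes b'$ if $\phi_i(b)>\varepsilon_i(b')$, else $b\otimes\tilde f_ib'$; $\tilde e_i(b\otimes b')=\tilde e_ib\otimes b'$ if $\phi_i(b)\ge\varepsilon_i(b')$, else $b\otimes\tilde e_ib'$. For $\tilde x_i\in\{\tilde e_i,\tilde f_i\}$, $\tilde x_i$ of a normal monomial $\varphi^{\ast p_n}_{j_n}\cdots\varphi^{\ast p_1}_{j_1}$ is obtained by applying $\tilde x_i$ to $\varphi^{\ast p_n}_{j_n}\otimes\cdots\otimes\varphi^{\ast p_1}_{j_1}\in B(p_n)\otimes\cdots\otimes B(p_1)$, multiplying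 out in $\mathcal A$, and dropping the sign; $\tilde x_i1=0$. **Restricted paths.** For $n\ge1$, $\mathcal P^k_{res,n}(0,l)$ is the set of $(p_n,\dots,p_1)\in\{0,1\}^n$ with $(-1)^{p_1}+\cdots+(-1)^{p_s}\in\{0,\dots,k\}$ for $1\le s\le n$ and $(-1)^{p_1}+\cdots+(-1)^{p_n}=l$. $\mathcal P^k_{res,0}(0,0)=\{\emptyset\}$, and $\mathcal P^k_{res,0}(0,l)$ is empty for $l\ne0$. **Path crystal.** For $m\in\{0,\dots,k\}$ let $\bar p_m(i)=m+(k-2m)\epsilon(i)$, $i\in\mathbb Z$; let $\bar p_{m,m'}(i)=\bar p_m(i)$ for $i\ge1$, $=\bar p_{m'}(i)$ for $i\le0$. The path realization identifies $B(\lambda_m)\otimes B(\lambda_{m'})^\ast$ with the set $\mathcal P^{(m,m')}$ of sequences $p=(p(i))_{i\in\mathbb Z}$, $p(i)\in\{0,\dots,k\}$, with $p(i)=\bar p_{m,m'}(i)$ for $|i|\gg0$. Each such $p$ corresponds uniquely to data $n\ge0$, walls $l_n\ge\cdots\ge l_1$ in $\mathbb Z$, and a region sequence $(m_n,\dots,m_0)\in\{0,\dots,k\}^{n+1}$ with $m_n=m$, $m_0=m'$, $|m_r-m_{r-1}|=1$, such that $p(i)=\bar p_{m_r}(i)$ for $l_r+1\le i\le l_{r+1}$ (with $l_0=-\infty$, $l_{n+1}=+\infty$; no condition if $l_r=l_{r+1}$), and whenever $l_{s+s'}>l_{s+s'-1}=\cdots=l_s>l_{s-1}$ one has $|m_{s+s'-1}-m_{s-1}|=s'$.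 For a given region sequence the path is written $[[l_n,\dots,l_1]]$; $[[\ ]]$ is the path with no walls. Crystal operators on paths: let $B^{(1)}=\{b_0,b_1\}$ with $\tilde f_1b_0=\tilde e_0b_0=b_1$, $\tilde e_1b_1=\tilde f_0b_1=b_0$, other actions $0$. Put $r_j=1$ if $p(l_j)+p(l_j+1)>k$ and $r_j=0$ if $p(l_j)+p(l_j+1)<k$ (equality does not occur at a wall). If $\tilde x_i(b_{r_n}\otimes\cdots\otimes b_{r_1})=0$ then $\tilde x_i[[l_n,\dots,l_1]]=0$; if $\tilde x_i$ acts on the $j$-th factor $b_{r_j}$, then $\tilde x_i[[l_n,\dots,l_1]]$ is obtained by replacing $l_j$ by $l_j+1$ (for $\tilde f_i$) or $l_j-1$ (for $\tilde e_i$), with the same region sequence. Weights of paths: $wt(p)=(m-m'+2s(p))(\Lambda_1-\Lambda_0)-h(p)\delta$, where $s(p)=\sum_i(\bar p_{m,m'}(i)-p(i))$, $h(p)=\sum_i i\big(\tilde H(p(i+1),p(i))-\tilde H(\bar p_{m,m'}(i+1),\bar p_{m,m'}(i))\big)$, and $\tilde H(a,b)=-b$ if $a+b\le k$, $=a-k$ if $a+b>k$. *)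

(* Defs.v *)
From HB Require Import structures.
From mathcomp Require Import all_boot all_order all_algebra.
From mathcomp Require Import generic_quotient ring_quotient.
From mathcomp Require Import boolp classical_sets fsbigop.
From mathcomp Require Import finmap.
From mathcomp.multinomials Require Import monalg.

Set Implicit Arguments.
Unset Strict Implicit.
Unset Printing Implicit Defensive.

Import Order.TTheory GRing.Theory Num.Theory.
Local Open Scope ring_scope.

(* Finite sequences with indices descending in the mathematics, such as
   (p_n, ..., p_1), (l_n, ..., l_1), (m_n, ..., m_0), are lists written in the
   same order: the head carries the largest index.  Upper indices p and crystal
   indices i are booleans, with false for 0 and true for 1. *)

(* [Lambda_0, Lambda_1, delta] coordinates *)
Definition weight := (int * int * int)%type.
Definition Lambda0 : weight := (1, 0, 0).
Definition Lambda1 : weight := (0, 1, 0).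
Definition delta : weight := (0, 0, 1).

Definition eps (j : int) : int := (j %% 2)%Z.

(* [None] plays the role of 0. *)
Record crystal := Crystal {
  carrier :> Type;
  wt : carrier -> weight;
  ce : bool -> carrier -> option carrier;
  cf : bool -> carrier -> option carrier }.

Definition csum (I : Type) (C : I -> crystal) : crystal := @Crystal {i : I & C i}
  (fun x => wt (tagged x))
  (fun i x => omap (fun b => existT _ (tag x) b) (ce i (tagged x)))
  (fun i x => omap (fun b => existT _ (tag x) b) (cf i (tagged x))).

Definition crystal_iso (C D : crystal) (F : C -> D) : Prop :=
  [/\ bijective F,
      forall i x, ce i (F x) = omap F (ce i x),
      forall i x, cf i (F x) = omap F (cf i x) &
      forall x, wt (F x) = wt x].

Definition iter_opt (T : Type) (f : T -> option T) (n : nat) (x : T) : option T :=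
  iter n (obind f) (Some x).

Definition max_iter (T : Type) (f : T -> option T) (x : T) : nat :=
  xget 0%N [set n | iter_opt f n x <> None /\
                    forall n', iter_opt f n' x <> None -> (n' <= n)%N]%classic.

Definition tensor_f (T U : Type) (fT : T -> option T) (eU fU : U -> option U)
    (x : T * U) : option (T * U) :=
  if (max_iter eU x.2 < max_iter fT x.1)%N
  then omap (fun b => (b, x.2)) (fT x.1) else omap (fun b => (x.1, b)) (fU x.2).

Definition tensor_e (T U : Type) (eT fT : T -> option T) (eU : U -> option U)
    (x : T * U) : option (T * U) :=
  if (max_iter eU x.2 <= max_iter fT x.1)%N
  then omap (fun b => (b, x.2)) (eT x.1) else omap (fun b => (x.1, b)) (eU x.2).

Definition ocons (T : Type) (o : option (T * seq T)) : option (seq T) :=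
  omap (fun x => x.1 :: x.2) o.

(* n-fold tensor products x_n (x) ... (x) x_1, bracketed to the right, for words of
   length n; the recursion is on n because the tensor rule iterates the operator
   of the tail. *)
Fixpoint word_e_rec (T : Type) (e f : T -> option T) (n : nat) (w : seq T) :
    option (seq T) :=
  match n, w with
  | n'.+1, x :: w' => ocons (tensor_e e f (word_e_rec e f n') (x, w'))
  | _, _ => None
  end.

Fixpoint word_f_rec (T : Type) (e f : T -> option T) (n : nat) (w : seq T) :
    option (seq T) :=
  match n, w with
  | n'.+1, x :: w' =>
      ocons (tensor_f f (word_e_rec e f n') (word_f_rec e f n') (x, w'))
  | _, _ => None
  end.

Definition word_e (T : Type) (e f : T -> option T) (w : seq T) : option (seq T) :=
  word_e_rec e f (size w) w.
Definition word_f (T : Type) (e f : T -> option T) (w : seq T) : option (seq T) :=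
  word_f_rec e f (size w) w.

(* The pair (p, j) stands for the generator phi^{*p}_j. *)
Definition gen := (bool * int)%type.

Definition H (p2 p1 : bool) : int := if p2 && ~~ p1 then 1 else 0.
Definition K (p2 p1 : bool) : int := 1 - H p2 p1.

Definition free_alg : pzRingType := {malg int[{fmonom gen}]}.
Definition free_gen (g : gen) : free_alg := mkmalgU (fmu g) 1.

Definition relator (p2 : bool) (j2 : int) (p1 : bool) (j1 : int) : free_alg :=
  let u := free_gen (p2, j2) * free_gen (p1, j1) in
  let v := free_gen (p2, j1 - 2 * K p2 p1 + eps (j1 + j2)) *
           free_gen (p1, j2 + 2 * K p2 p1 - eps (j1 + j2)) in
  if u == v then u else u + v.

(* the two-sided ideal generated by the relators *)
Inductive rel_ideal : free_alg -> Prop :=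
| RelIdeal0 : rel_ideal 0
| RelIdealB x y : rel_ideal x -> rel_ideal y -> rel_ideal (x - y)
| RelIdealG a b p2 j2 p1 j1 : rel_ideal (a * relator p2 j2 p1 j1 * b).

Definition in_rel_ideal : {pred free_alg} := fun x => `[< rel_ideal x >].

Lemma rel_ideal_zmod : zmod_closed in_rel_ideal.
Proof.
split; first by apply/asboolP; constructor.
by move=> x y /asboolP hx /asboolP hy; apply/asboolP; constructor.
Qed.

HB.instance Definition _ :=
  GRing.isZmodClosed.Build free_alg in_rel_ideal rel_ideal_zmod.

Lemma rel_idealMl a x : rel_ideal x -> rel_ideal (a * x).
Proof.
elim=> [|y z _ hy _ hz|c b p2 j2 p1 j1].
- by rewrite mulr0; constructor.
- by rewrite mulrBr; constructor.
- by rewrite !mulrA -(mulrA a); rewrite mulrA; constructor.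
Qed.

Lemma rel_idealMr a x : rel_ideal x -> rel_ideal (x * a).
Proof.
elim=> [|y z _ hy _ hz|c b p2 j2 p1 j1].
- by rewrite mul0r; constructor.
- by rewrite mulrBl; constructor.
- by rewrite -(mulrA _ b); constructor.
Qed.

Definition creation_alg : Type := Quotient.quot in_rel_ideal.
HB.instance Definition _ := GRing.Zmodule.on creation_alg.
HB.instance Definition _ := EqQuotient.on creation_alg.

Local Open Scope quotient_scope.

Definition ca_one : creation_alg := \pi_creation_alg (1 : free_alg).
Definition ca_mul (x y : creation_alg) : creation_alg :=
  \pi_creation_alg (repr x * repr y : free_alg).

Lemma ca_piP (x y : free_alg) :
  rel_ideal (x - y) <-> \pi_creation_alg x = \pi_creation_alg y.
Proof.
split=> [h|]; first by apply/eqmodP; apply/asboolP.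
by move=> /eqmodP /asboolP.
Qed.

Lemma ca_mulE (x y : free_alg) :
  ca_mul (\pi x) (\pi y) = \pi_creation_alg (x * y).
Proof.
apply/ca_piP; set x' := repr _; set y' := repr _.
have -> : x' * y' - x * y = x' * (y' - y) - (x - x') * y.
  by rewrite mulrBr mulrBl opprB addrA subrK.
by constructor; [apply: rel_idealMl | apply: rel_idealMr]; apply/ca_piP;
  rewrite reprK.
Qed.

Lemma ca_mulA : associative ca_mul.
Proof.
elim/quotW=> x; elim/quotW=> y; elim/quotW=> z.
by rewrite (ca_mulE y) (ca_mulE x) (ca_mulE x) (ca_mulE _ z) mulrA.
Qed.

Lemma ca_mul1 : left_id ca_one ca_mul.
Proof. by elim/quotW=> x; rewrite ca_mulE mul1r. Qed.

Lemma ca_mulr1 : right_id ca_one ca_mul.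
Proof. by elim/quotW=> x; rewrite ca_mulE mulr1. Qed.

Lemma ca_piD (x y : free_alg) :
  \pi_creation_alg (x + y) = \pi_creation_alg x + \pi_creation_alg y.
Proof. exact: (Quotient.pi_add in_rel_ideal). Qed.

Lemma ca_mulDl : left_distributive ca_mul +%R.
Proof.
elim/quotW=> x; elim/quotW=> y; elim/quotW=> z.
by rewrite -ca_piD (ca_mulE _ z) (ca_mulE x) (ca_mulE y) mulrDl ca_piD.
Qed.

Lemma ca_mulDr : right_distributive ca_mul +%R.
Proof.
elim/quotW=> x; elim/quotW=> y; elim/quotW=> z.
by rewrite -ca_piD (ca_mulE x) (ca_mulE x) (ca_mulE x) mulrDr ca_piD.
Qed.

HB.instance Definition _ := GRing.Zmodule_isPzRing.Build creation_alg
  ca_mulA ca_mul1 ca_mulr1 ca_mulDl ca_mulDr.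

Definition phi (g : gen) : creation_alg := \pi_creation_alg (free_gen g).

Definition monomial (w : seq gen) : creation_alg := \prod_(g <- w) phi g.

Local Close Scope quotient_scope.

Definition normal (w : seq gen) : bool :=
  sorted (fun g2 g1 => 2 * H g2.1 g1.1 <= g2.2 - g1.2) w.

(* B(p_n, ..., p_1), each normal monomial being represented by its word; distinct
   normal words have distinct values in the creation algebra. *)
Definition nmonomial (p : seq bool) : choiceType :=
  {w : seq gen | (unzip1 w == p) && normal w}.

Definition gen_wt (g : gen) : weight :=
  (Lambda1 - Lambda0) *~ (1 - 2 * eps g.2) - delta *~ (g.2 %/ 2)%Z.

(* f_1 is defined on phi_j for j even and f_0 for j odd; e_i the opposite. *)
Definition gen_f (i : bool) (g : gen) : option gen :=
  if (eps g.2 == 0) == i then Some (g.1, g.2 + 1) else None.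
Definition gen_e (i : bool) (g : gen) : option gen :=
  if (eps g.2 == 1) == i then Some (g.1, g.2 - 1) else None.

(* 0 if the monomial of [w] vanishes in the creation algebra, and otherwise the
   normal monomial equal to it up to sign ([b] is only a default value) *)
Definition normal_form (p : seq bool) (b : nmonomial p) (w : seq gen) :
    option (nmonomial p) :=
  if monomial w == 0 then None else
  Some (xget b [set b' : nmonomial p | monomial w = monomial (val b') \/
                                       monomial w = - monomial (val b')]%classic).

Definition B (p : seq bool) : crystal := @Crystal (nmonomial p)
  (fun b => \sum_(g <- val b) gen_wt g)
  (fun i b => obind (normal_form b) (word_e (gen_e i) (gen_f i) (val b)))
  (fun i b => obind (normal_form b) (word_f (gen_e i) (gen_f i) (val b))).

Definition height (p : seq bool) : int := \sum_(b <- p) (-1) ^+ (b : nat).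

Definition respath (k : nat) (l : int) (p : seq bool) : bool :=
  all (fun t => 0 <= height (drop t p) <= k%:Z) (iota 0 (size p)) &&
  (height p == l).

(* (m_n, ..., m_0) with m_s = (-1)^{p_1} + ... + (-1)^{p_s} *)
Definition regions (p : seq bool) : seq int :=
  [seq height (drop t p) | t <- iota 0 (size p).+1].

(* the disjoint union, over all lengths n = size p, of the crystals B p *)
Definition res_crystal (k : nat) (l : int) : crystal :=
  csum (fun p : {p : seq bool | respath k l p} => B (val p)).

Definition pbar (k : nat) (m i : int) : int := m + (k%:Z - 2 * m) * eps i.

Definition pbar2 (k : nat) (m m' i : int) : int :=
  if 1 <= i then pbar k m i else pbar k m' i.

Definition is_path (k : nat) (m m' : int) (p : int -> int) : Prop :=
  (forall i, 0 <= p i <= k%:Z) /\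
  exists N : int, forall i, N <= `|i| -> p i = pbar2 k m m' i.

Definition kpath (k : nat) (m m' : int) :=
  {p : int -> int | `[< is_path k m m' p >]}.

Definition region_seq (k : nat) (m m' : int) (n : nat) (ms : seq int) : bool :=
  [&& size ms == n.+1, head 0 ms == m, last 0 ms == m',
      all (fun x => 0 <= x <= k%:Z) ms & sorted (fun a b => `|a - b| == 1) ms].

(* l_s for 1 <= s <= n, and m_r for 0 <= r <= n *)
Definition wall (ls : seq int) (s : nat) : int := nth 0 (rev ls) s.-1.
Definition region (ms : seq int) (r : nat) : int := nth 0 (rev ms) r.

(* For weakly ordered walls, l_r + 1 <= i <= l_{r+1} holds exactly when r is the
   number of walls l_s < i. *)
Definition wall_fun (k : nat) (ls ms : seq int) (i : int) : int :=
  pbar k (region ms (count (fun l => l < i) ls)) i.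

Definition reduced (ls ms : seq int) : Prop :=
  forall s s' : nat, (0 < s)%N -> (0 < s')%N -> (s + s' <= (size ls).+1)%N ->
    (s + s' = (size ls).+1 \/ wall ls (s + s').-1 < wall ls (s + s')) ->
    (forall t, (s <= t < s + s')%N -> wall ls t = wall ls s) ->
    (s = 1%N \/ wall ls s.-1 < wall ls s) ->
    `|region ms (s + s').-1 - region ms s.-1| = s'%:Z.

Definition wall_data (k : nat) (m m' : int) (p : int -> int)
    (d : seq int * seq int) : Prop :=
  [/\ sorted (fun a b => b <= a) d.1, region_seq k m m' (size d.1) d.2,
      reduced d.1 d.2 & p =1 wall_fun k d.1 d.2].

(* the unique wall data of a path *)
Definition get_walls (k : nat) (m m' : int) (p : kpath k m m') :
    seq int * seq int :=
  xget ([::], [::]) [set d | wall_data k m m' (val p) d]%classic.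

(* the crystal B^(1): b_0 and b_1 are false and true *)
Definition b1_f (i r : bool) : option bool := if r != i then Some (~~ r) else None.
Definition b1_e (i r : bool) : option bool := if r == i then Some (~~ r) else None.

Definition signs (k : nat) (p : int -> int) (ls : seq int) : seq bool :=
  [seq k%:Z < p l + p (l + 1) | l <- ls].

(* Moves by [d] the wall on whose factor the operator acted: it is the only one whose
   sign differs in [rs] and [rs']. *)
Definition move (d : int) (ls : seq int) (rs rs' : seq bool) : seq int :=
  [seq if x.2.1 != x.2.2 then x.1 + d else x.1 | x <- zip ls (zip rs rs')].

(* [insub] only checks that the new sequence lies in the set of paths. *)
Definition path_act (k : nat) (m m' : int) (op : seq bool -> option (seq bool))
    (d : int) (p : kpath k m m') : option (kpath k m m') :=
  let ls := (get_walls p).1 in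
  let ms := (get_walls p).2 in
  let rs := signs k (val p) ls in
  obind (fun rs' => insub (wall_fun k (move d ls rs rs') ms)) (op rs).

Definition Htilde (k : nat) (a b : int) : int :=
  if a + b <= k%:Z then - b else a - k%:Z.

Definition path_s (k : nat) (m m' : int) (p : int -> int) : int :=
  \sum_(i \in [set: int]) (pbar2 k m m' i - p i).

Definition path_h (k : nat) (m m' : int) (p : int -> int) : int :=
  \sum_(i \in [set: int])
    i * (Htilde k (p (i + 1)) (p i) -
         Htilde k (pbar2 k m m' (i + 1)) (pbar2 k m m' i)).

Definition path_wt (k : nat) (m m' : int) (p : int -> int) : weight :=
  (Lambda1 - Lambda0) *~ (m - m' + 2 * path_s k m m' p) - delta *~ path_h k m m' p.

(* the path realization of B(lambda_m) (x) B(lambda_m')^* *)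
Definition path_crystal (k : nat) (m m' : int) : crystal := @Crystal (kpath k m m')
  (fun p => path_wt k m m' (val p))
  (fun i p => path_act (word_e (b1_e i) (b1_f i)) (-1) p)
  (fun i p => path_act (word_f (b1_e i) (b1_f i)) 1 p).

Lemma wall_fun_path (k : nat) (m m' : int) (ls ms : seq int) :
  region_seq k m m' (size ls) ms -> is_path k m m' (wall_fun k ls ms).
Proof.
case/and5P=> /eqP sz /eqP hd /eqP lst /allP rng _.
have szr : size (rev ms) = (size ls).+1 by rewrite size_rev.
split=> [i|].
  have : region ms (count (fun l => l < i) ls) \in ms.
    by rewrite -mem_rev; apply: mem_nth; rewrite szr ltnS count_size.
  move=> /rng /andP[h1 h2]; rewrite /wall_fun /pbar.
  have : eps i = 0 \/ eps i = 1.
    rewrite /eps; have := modz_ge0 i (isT : (2 : int) != 0).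
    have := ltz_mod i (isT : (2 : int) != 0).
    by case: (i %% 2)%Z => [[|[|]]|] // _ _; [left|right].
  case=> ->; first by rewrite mulr0 addr0 h1.
  have -> : region ms (count (fun l => l < i) ls) +
     (k%:Z - 2 * region ms (count (fun l => l < i) ls)) * 1 =
     k%:Z - region ms (count (fun l => l < i) ls).
    rewrite mulr1 mulr2n mulrDl !mul1r addrC -addrA; congr (_ + _).
    by rewrite opprD -addrA addNr addr0.
  by rewrite subr_ge0 h2 /= lerBlDr lerDl.
have hsum l : l \in ls -> `|l| <= \sum_(x <- ls) `|x|.
  move=> hl; rewrite (big_rem l hl) /= lerDl.
  by apply: sumr_ge0.
exists (1 + \sum_(x <- ls) `|x|) => i.
have s0 : 0 <= \sum_(x <- ls) `|x| by apply: sumr_ge0.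
rewrite /wall_fun /pbar2; case: (lerP 1 i) => hi hN.
- rewrite ger0_norm in hN; last by apply: le_trans hi.
  have /eqP -> : count (fun l => l < i) ls == size ls.
    rewrite -all_count; apply/allP=> l /hsum hl.
    apply: le_lt_trans (ler_norm l) _; apply: le_lt_trans hl _.
    by apply: lt_le_trans hN; rewrite ltrDr.
  by rewrite /region nth_rev sz // subnn nth0 hd.
- have hi0 : i <= 0 by rewrite -ltzD1 add0r.
  rewrite ler0_norm // in hN.
  have /eqP -> : count (fun l => l < i) ls == 0%N.
    rewrite eqn0Ngt -has_count; apply/hasPn=> l /hsum hl.
    rewrite -leNgt -lerN2; apply: le_trans (_ : `|l| <= _); first by rewrite -normrN ler_norm.
    by apply: le_trans hl _; apply: le_trans hN; rewrite lerDr.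
  by rewrite /region nth_rev sz // subn1 /= -lst (last_nth 0); case: ms sz {hd lst rng szr} => //= x ms [->].
Qed.

Lemma asbool_wall_fun_path (k : nat) (m m' : int) (ls ms : seq int) :
  region_seq k m m' (size ls) ms -> `[< is_path k m m' (wall_fun k ls ms) >].
Proof. by move/wall_fun_path/asboolP. Qed.

(* the path [[l_n, ..., l_1]] with region sequence [ms] *)
Definition wall_path (k : nat) (m m' : int) (ls ms : seq int)
    (h : region_seq k m m' (size ls) ms) : kpath k m m' :=
  exist _ (wall_fun k ls ms) (asbool_wall_fun_path h).

Lemma regions_seq (k : nat) (l : int) (p : seq bool) :
  respath k l p -> region_seq k l 0 (size p) (regions p).
Proof.
case/andP=> /allP rng /eqP hl.
apply/and5P; split.
- by rewrite size_map size_iota.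
- by rewrite /regions /= drop0 hl.
- rewrite /regions -addn1 iotaD map_cat last_cat /= add0n drop_size.
  by rewrite /height big_nil.
- apply/allP=> x /mapP[t]; rewrite mem_iota => /andP[_ ht] ->.
  have [lt|ge] := ltnP t (size p); first by apply: rng; rewrite mem_iota.
  by rewrite drop_oversize // /height big_nil lexx.
- rewrite /regions; elim: p {rng hl} => [|b p IH] //=.
  rewrite /= drop0; apply/andP; split.
    by rewrite /height big_cons addrK normrX normrN1 expr1n.
  move: IH; rewrite /= drop0; congr (path _ _ _).
  by rewrite -[2%N]/(1 + 1)%N iotaDl -map_comp.
Qed.

Lemma nmonomial_region_seq (k : nat) (l : int) (p : {p : seq bool | respath k l p})
    (b : nmonomial (val p)) :
  region_seq k l 0 (size [seq g.2 - (g.1 : bool)%:Z | g : gen <- val b]) (regions (val p)).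
Proof.
rewrite size_map; have /andP[/eqP h _] := valP b.
by rewrite -(size_map fst) -/(unzip1 _) h regions_seq //; apply: valP.
Qed.

(* phi^{*p_n}_{j_n} ... phi^{*p_1}_{j_1} |-> [[j_n - p_n, ..., j_1 - p_1]];
   for n = 0 this is 1 |-> [[ ]], the path without walls, with region sequence (0). *)
Definition theta (k : nat) (l : int) (x : res_crystal k l) : path_crystal k l 0 :=
  wall_path (nmonomial_region_seq (tagged x)).

(* Main.v *)
From HB Require Import structures.
Require Import Defs.
From mathcomp Require Import all_boot all_order all_algebra.
From mathcomp Require Import generic_quotient finmap.
From mathcomp Require Import boolp classical_sets fsbigop.
From mathcomp.multinomials Require Import monalg.
From mathcomp Require Import zify ring.

(** Write j = 2a + e with e = eps j.  The relations of the creation algebra keep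
    the upper indices and the parities of a monomial in place, and after a shift
    of the numbers a by constants depending only on these data they become
    transpositions with a sign: for fixed types of the factors the algebra is an
    exterior power.  Hence normal monomials are nonzero and pairwise distinct up
    to sign, which can already be seen modulo 2.

    A path p is determined by its region function R(i) = pbar k (p i) i, which is
    constant near both ends.  The walls of p are the points where R jumps, and a
    word is normal exactly when its walls are weakly ordered and the steps taken
    at a common wall all have the same sign.  So a normal word can be recovered
    from its region function, which is the sum of the steps at the walls < i.

    The sign of the path at a wall is the parity of the corresponding index j, so
    the two tensor product rules agree; on a normal word they act on a factor
    that can be moved without losing normality.  Weights are compared through
    summation by parts. *)

Set Implicit Arguments.
Unset Strict Implicit.
Unset Printing Implicit Defensive.

Import Order.TTheory GRing.Theory Num.Theory.
Local Open Scope ring_scope.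

(** * Linear independence of normal monomials *)

Lemma epsP j : {h : int | j = 2 * h & eps j = 0} + {h : int | j = 2 * h + 1 & eps j = 1}.
Proof.
have e := divz_eq j 2; rewrite /eps.
have : ((j %% 2)%Z == 0) || ((j %% 2)%Z == 1) by lia.
by case: eqP => [h _|_ /= /eqP h]; [left|right]; exists (j %/ 2)%Z; lia.
Qed.

Lemma epsS j : eps (j + 1) = 1 - eps j.
Proof. by rewrite /eps; lia. Qed.

Lemma epsB (j : int) (b : bool) : eps (j - b%:Z) = if b then 1 - eps j else eps j.
Proof. by case: b; rewrite /eps; lia. Qed.

Definition types (w : seq gen) : seq (bool * int) := [seq (g.1, eps g.2) | g <- w].

(** With j = 2a + e, normality of two neighbours reads a2 - a1 >= H + (1 - e2) e1. As [K] is 1 - H,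
    adding the offsets turns this bound into a strict inequality. *)
Fixpoint offset (t : seq (bool * int)) : int :=
  match t with
  | g2 :: (g1 :: _) as t' => offset t' + K g2.1 g1.1 - (1 - g2.2) * g1.2
  | _ => 0
  end.

Lemma offset_cons g2 g1 t :
  offset [:: g2, g1 & t] = offset (g1 :: t) + K g2.1 g1.1 - (1 - g2.2) * g1.2.
Proof. by []. Qed.
Arguments offset : simpl never.

(* The shifted numbers a: an exchange relation swaps two neighbouring slots, and a
   normal word is one whose slots strictly decrease. *)
Fixpoint slots (w : seq gen) : seq int :=
  if w is g :: w' then (g.2 %/ 2)%Z + offset (types w) :: slots w' else [::].

Definition exchange (g2 g1 : gen) : gen * gen :=
  ((g2.1, g1.2 - 2 * K g2.1 g1.1 + eps (g1.2 + g2.2)),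
   (g1.1, g2.2 + 2 * K g2.1 g1.1 - eps (g1.2 + g2.2))).

(** The correction [eps (j1 + j2)] lets each position keep its parity, hence its offset; the shift
    by [2 * K] then compensates the difference of the two offsets. *)
Lemma exchange_slots x g2 g1 y :
  let w := x ++ g2 :: g1 :: y in
  let w' := x ++ (exchange g2 g1).1 :: (exchange g2 g1).2 :: y in
  types w' = types w /\ perm_eq (slots w') (slots w).
Proof.
move=> w w'; rewrite {}/w {}/w'.
elim: x => [|g x [IHt IHs]] /=; last first.
  by rewrite IHt; split=> //; rewrite perm_cons.
case: g2 g1 => p2 j2 [p1 j1] /=.
have e1 : eps (j2 + 2 * K p2 p1 - eps (j1 + j2)) = eps j1 by rewrite /eps; lia.
have e2 : eps (j1 - 2 * K p2 p1 + eps (j1 + j2)) = eps j2 by rewrite /eps; lia.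
rewrite e1 e2; split=> //; rewrite !offset_cons /=; move: (offset _) => o.
set x1 := _ + o; set x2 := _ + _.
have -> : x2 = (j1 %/ 2)%Z + o.
  by rewrite /x2; case: (epsP j1) => - [? -> ->]; case: (epsP j2) => - [? -> ->]; rewrite /eps; lia.
have -> : x1 = (j2 %/ 2)%Z + (o + K p2 p1 - (1 - eps j2) * eps j1).
  by rewrite /x1; case: (epsP j1) => - [? -> ->]; case: (epsP j2) => - [? -> ->]; rewrite /eps; lia.
exact/permPl/(perm_catCA [:: _] [:: _]).
Qed.

(** Two slots that are swapped without changing the word are equal. This is the case in which a
    relation kills its monomial. *)
Lemma exchange_fixed_slots x g2 g1 y :
  exchange g2 g1 = (g2, g1) -> ~~ uniq (slots (x ++ g2 :: g1 :: y)).
Proof.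
move=> h; elim: x => [|g x IH] /=; last by rewrite negb_and IH orbT.
case: g2 g1 h => p2 j2 [p1 j1] [/= h1 h2].
rewrite negb_and negbK inE; apply/orP; left.
rewrite !offset_cons /=; move: (offset _) => o; apply/orP; left; apply/eqP.
move: h1 h2.
case: (epsP j1) => - [? -> ->]; case: (epsP j2) => - [? -> ->]; rewrite /eps; lia.
Qed.

Lemma normal_slots w : normal w -> sorted (fun a b : int => b < a) (slots w).
Proof.
elim: w => [|[p2 j2] [|[p1 j1] y] IH] // /andP[h1 h2].
have {IH} := IH h2; rewrite -[slots _ in X in _ -> X]/(_ :: slots ((p1,j1) :: y)) /= => ->.
rewrite andbT; rewrite !offset_cons /=; move: (offset _) => o; move: h1 => /=; rewrite /K.
by case: (epsP j1) => - [? -> ->]; case: (epsP j2) => - [? -> ->]; lia.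
Qed.

Lemma types_slots_inj w w' : types w = types w' -> slots w = slots w' -> w = w'.
Proof.
elim: w w' => [|[p j] w IH] [|[p' j'] w'] //= [hp he ht].
rewrite -he -hp -ht => -[/addIr hj hs]; rewrite (IH w') //; congr ((_, _) :: _) => //.
by rewrite (divz_eq j 2) (divz_eq j' 2) hj -!/(eps _) he.
Qed.

Definition slot_match (w0 w : seq gen) : bool :=
  (types w == types w0) && perm_eq (slots w) (slots w0).

Lemma slot_match_normal w0 w : normal w0 -> normal w -> slot_match w0 w -> w = w0.
Proof.
move=> n0 n /andP[/eqP ht hs]; apply: types_slots_inj => //.
apply: (@sorted_eq _ (fun a b : int => b < a)) hs; try exact: normal_slots.
- by move=> a b c h1 h2; apply: lt_trans h2 h1.
- by move=> a b /andP[h1 h2]; have := lt_trans h1 h2; rewrite ltxx.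
Qed.

(* The coefficient of [w0], modulo 2 so that the signs disappear. *)
Definition slot_form (w0 : seq gen) (x : free_alg) : 'F_2 :=
  mmap (intmul 1 : int -> 'F_2) (fun m : {fmonom gen} => (slot_match w0 m)%:R) x.

Lemma slot_form_additive w0 : additive (slot_form w0).
Proof. exact: mmap_is_additive. Qed.
HB.instance Definition _ w0 := GRing.isAdditive.Build free_alg 'F_2 (slot_form w0)
  (slot_form_additive w0).

Definition free_word (w : seq gen) : free_alg := \prod_(g <- w) free_gen g.

Definition fword (w : seq gen) : {fmonom gen} := foldr (fun g m => mmul (fmu g) m) mone w.

Lemma fwordE w : fword w = w :> seq gen.
Proof. by elim: w => [|g w IH]; rewrite ?fm1 //= fmM IH fmuE. Qed.

Lemma free_wordE w : free_word w = mkmalgU (fword w) 1.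
Proof.
elim: w => [|g w IH]; rewrite /free_word ?big_nil // big_cons -/(free_word w) IH /=.
by rewrite /free_gen malgM_def fgmulUU mulr1.
Qed.

Lemma slot_form_monom w0 (c : int) (m : {fmonom gen}) :
  slot_form w0 (mkmalgU m c) = c%:~R * (slot_match w0 m)%:R.
Proof. exact: mmapU. Qed.

Lemma slot_form_free_word w0 w : slot_form w0 (free_word w) = (slot_match w0 w)%:R.
Proof. by rewrite free_wordE slot_form_monom mul1r fwordE. Qed.

Lemma slot_form_sandwich w0 (a r b : free_alg) :
  (forall (m1 : {fmonom gen}) (c1 : int) (m2 : {fmonom gen}) (c2 : int),
    slot_form w0 ((mkmalgU m1 c1 : free_alg) * r * (mkmalgU m2 c2 : free_alg)) = 0) ->
  slot_form w0 (a * r * b) = 0.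
Proof.
move=> h.
have -> : a = \sum_(k <- msupp a) mkmalgU k a@_k by exact: monalgE.
rewrite -mulrA mulr_suml raddf_sum big1 // => m1 _; move: a@_m1 => c1; rewrite /= mulrA.
have -> : b = \sum_(k <- msupp b) mkmalgU k b@_k by exact: monalgE.
by rewrite mulr_sumr raddf_sum big1 // => m2 _; exact: h.
Qed.

(** Two distinct monomials of a relator match [w0] simultaneously, and their contributions add up to
    2 = 0. A monomial equal to its exchange has a repeated slot, whereas the slots of a normal word
    are distinct. *)
Lemma slot_form_relator w0 (a b : free_alg) p2 j2 p1 j1 : normal w0 ->
  slot_form w0 (a * relator p2 j2 p1 j1 * b) = 0.
Proof.
move=> n0; apply: slot_form_sandwich => m1 c1 m2 c2.
have gen2 (g g' : gen) :
    slot_form w0 ((mkmalgU m1 c1 : free_alg) * (free_gen g * free_gen g')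
      * (mkmalgU m2 c2 : free_alg))
      = (c1 * c2)%:~R * (slot_match w0 (m1 ++ g :: g' :: m2))%:R.
  rewrite /free_gen !malgM_def !fgmulUU !mulr1 slot_form_monom.
  by rewrite !fmM !fmuE /= -!catA.
have [ht hs] := exchange_slots m1 (p2, j2) (p1, j1) m2.
rewrite /relator; case: ifP => [/eqP /= e|_]; last first.
  rewrite mulrDr mulrDl raddfD; apply: etrans (f_equal2 (fun x y : 'F_2 => x + y) (gen2 _ _) (gen2 _ _)) _.
  rewrite -mulrDr.
  have -> : slot_match w0 (m1 ++ (p2, j1 - 2 * K p2 p1 + eps (j1 + j2))
        :: (p1, j2 + 2 * K p2 p1 - eps (j1 + j2)) :: m2) =
      slot_match w0 (m1 ++ (p2, j2) :: (p1, j1) :: m2).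
    rewrite /slot_match -ht; congr (_ && _).
    by apply/idP/idP; apply: perm_trans; rewrite // perm_sym.
  rewrite -mulr2n -[_ *+ 2]mulr_natr; have -> : 2%:R = 0 :> 'F_2 by exact/val_inj.
  by rewrite !mulr0.
apply: etrans (gen2 _ _) _.
suff -> : slot_match w0 (m1 ++ (p2, j2) :: (p1, j1) :: m2) = false by rewrite mulr0.
apply/negP=> /andP[_ hp].
have : uniq (slots (m1 ++ (p2, j2) :: (p1, j1) :: m2)).
  rewrite (perm_uniq hp); apply: (@sorted_uniq _ (fun a b : int => b < a)).
  - by move=> x y z h1 h2; apply: lt_trans h2 h1.
  - by move=> x; rewrite ltxx.
  - exact: normal_slots.
apply/negP/exchange_fixed_slots.
move: e; rewrite /free_gen !malgM_def !fgmulUU mulr1 => e.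
(* Reading off one coefficient turns the equality in the free algebra into an equality of words,
   that is, a fixed point of [exchange]. *)
have := congr1 (fun x : free_alg => x@_(mmul (fmu (p2, j2)) (fmu (p1, j1)))) e.
rewrite /= mcoeffUU mcoeffU; case: eqP => // + _.
move=> /(congr1 (fun m : {fmonom gen} => m : seq gen)); rewrite !fmM !fmuE /= /exchange.
by case=> -> ->.
Qed.

Lemma slot_form_ideal w0 x : normal w0 -> rel_ideal x -> slot_form w0 x = 0.
Proof.
move=> n0; elim=> [|y z _ hy _ hz|a b p2 j2 p1 j1].
- by rewrite raddf0.
- by rewrite raddfB /= hy hz subrr.
- exact: slot_form_relator.
Qed.

Local Open Scope quotient_scope.

Lemma monomialE w : monomial w = \pi_creation_alg (free_word w).
Proof.
elim: w => [|g w IH]; rewrite /monomial /free_word ?big_nil // !big_cons.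
by rewrite -/(monomial w) IH -[LHS]/(ca_mul _ _) ca_mulE.
Qed.

Lemma ca_pi_eq0 (x : free_alg) : \pi_creation_alg x = 0 -> rel_ideal x.
Proof.
have pi0 : \pi_creation_alg (0 : free_alg) = 0.
  by apply: (addrI (\pi_creation_alg (0 : free_alg))); rewrite -ca_piD !addr0.
by rewrite -pi0 => /ca_piP; rewrite subr0.
Qed.

Local Close Scope quotient_scope.

Lemma slot_matchxx w : slot_match w w.
Proof. by rewrite /slot_match eqxx perm_refl. Qed.

Lemma normal_monomial_neq0 w : normal w -> monomial w != 0.
Proof.
move=> n; apply/eqP; rewrite monomialE => /ca_pi_eq0.
by move/(slot_form_ideal n); rewrite slot_form_free_word slot_matchxx => /eqP; rewrite oner_eq0.
Qed.

(** The form attached to [w] is 1 on [w], and modulo 2 the sign is invisible, so it is nonzero on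
    [w'] as well; hence [w'] matches [w]. *)
Lemma normal_monomial_inj w w' : normal w -> normal w' ->
  monomial w = monomial w' \/ monomial w = - monomial w' -> w = w'.
Proof.
move=> n n' h; suff hs : slot_match w w' by rewrite (slot_match_normal n n' hs).
have : slot_form w (free_word w) = slot_form w (free_word w') \/
       slot_form w (free_word w) = - slot_form w (free_word w').
  case: h; rewrite !monomialE.
    by move/ca_piP/(slot_form_ideal n)/eqP; rewrite raddfB subr_eq0 => /eqP; left.
  move/eqP; rewrite -addr_eq0 -ca_piD => /eqP/ca_pi_eq0.
  by move/(slot_form_ideal n)/eqP; rewrite raddfD addr_eq0 => /eqP; right.
rewrite !slot_form_free_word slot_matchxx; case: (slot_match w w') => //.
by case=> /eqP; rewrite ?oppr0 oner_eq0.
Qed.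

(** Uniqueness up to sign forces the choice made by [xget]. Once the word operators are known to
    preserve normality, multiplying out therefore changes nothing. *)
Lemma normal_formE p (b : nmonomial p) w (h : (unzip1 w == p) && normal w) :
  normal_form b w = Some (exist _ w h).
Proof.
have n : normal w by case/andP: h.
rewrite /normal_form (negPf (normal_monomial_neq0 n)); congr Some.
apply: xget_unique => /=; first by left.
move=> b' /= hb'; apply: val_inj => /=; apply/esym/normal_monomial_inj => //.
by case/andP: (valP b').
Qed.

(** * The tensor product rule on normal words *)

Section MaxIter.
Variables (T : Type) (f : T -> option T).

Lemma iter_optS n x : iter_opt f n.+1 x = obind f (iter_opt f n x).
Proof. by []. Qed.

Lemma iter_optSr n x : iter_opt f n.+1 x = obind (iter_opt f n) (f x).
Proof.
rewrite /iter_opt iterSr /=; case: (f x) => //=.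
by elim: n => //= n ->.
Qed.

Lemma max_iterE n x :
  iter_opt f n x <> None -> iter_opt f n.+1 x = None -> max_iter f x = n.
Proof.
move=> h1 h2; have stop m : (n < m)%N -> iter_opt f m x = None.
  move=> /subnK <-; elim: (_ - _)%N => // d IH.
  by rewrite addSn iter_optS IH.
have ub m : iter_opt f m x <> None -> (m <= n)%N.
  by move=> hm; rewrite leqNgt; apply/negP => /stop.
apply: xget_unique => //= m [hm hm'].
by apply/eqP; rewrite eqn_leq ub //= hm'.
Qed.

Hypothesis (mu : T -> nat) (mu_dec : forall x y, f x = Some y -> (mu y < mu x)%N).

(** [max_iter] defaults to 0 when the iterates never stop; the decreasing measure [mu] excludes
    this. *)
Lemma max_iter_eq0 x : (max_iter f x == 0)%N = ~~ f x.
Proof.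
case fx : (f x) => [y|] /=; last first.
  by rewrite (@max_iterE 0%N).
suff [n hn hn'] : exists2 n, iter_opt f n.+1 x <> None & iter_opt f n.+2 x = None.
  by rewrite (max_iterE hn hn').
have [m hm] := ubnP (mu x); elim: m x y fx hm => // m IH x y fx hm.
case fy : (f y) => [z|].
  have [|n hn hn'] := IH y z fy.
    exact: leq_trans (mu_dec fx) hm.
  by exists n.+1; rewrite iter_optSr fx.
by exists 0; rewrite ?iter_optSr fx //= /iter_opt /= fy.
Qed.

End MaxIter.

Lemma max_iter_morph (T U : Type) (h : T -> U) f g (x : T) :
  (forall x, g (h x) = omap h (f x)) -> max_iter g (h x) = max_iter f x.
Proof.
move=> hfg; have it n : iter_opt g n (h x) = omap h (iter_opt f n x).
  elim: n => // n IH; rewrite !iter_optS IH.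
  by case: (iter_opt f n x) => /=.
have itN n : (iter_opt g n (h x) <> None) = (iter_opt f n x <> None).
  by apply/propext; rewrite it; case: (iter_opt f n x).
rewrite /max_iter; congr xget; apply/funext => n /=.
rewrite itN; congr (_ /\ _); apply/propext; split=> H m.
  by have := H m; rewrite itN.
by rewrite itN; apply: H.
Qed.

Section WordMorph.
Variables (T U : Type) (h : T -> U) (e f : T -> option T) (e' f' : U -> option U).
Hypotheses (he : forall x, e' (h x) = omap h (e x))
           (hf : forall x, f' (h x) = omap h (f x)).

(** The tensor rule compares only string lengths, which a map commuting with both operators
    preserves. The map of interest is [gsign], from generators to the crystal of signs. *)
Lemma word_e_rec_map n w :
  word_e_rec e' f' n (map h w) = omap (map h) (word_e_rec e f n w).
Proof.
elim: n w => [|n IH] [|x w] //=; rewrite /tensor_e /=.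
rewrite (max_iter_morph _ IH) (max_iter_morph _ hf).
case: ifP => _; first by rewrite he; case: (e x).
by rewrite IH; case: (word_e_rec e f n w).
Qed.

Lemma word_f_rec_map n w :
  word_f_rec e' f' n (map h w) = omap (map h) (word_f_rec e f n w).
Proof.
elim: n w => [|n IH] [|x w] //=; rewrite /tensor_f /=.
rewrite (max_iter_morph _ (word_e_rec_map n)) (max_iter_morph _ hf).
case: ifP => _; first by rewrite hf; case: (f x).
by rewrite IH; case: (word_f_rec e f n w).
Qed.

End WordMorph.

Section GenWord.
Variable i : bool.
Notation E := (word_e_rec (gen_e i) (gen_f i)).
Notation F := (word_f_rec (gen_e i) (gen_f i)).

Lemma gen_e_f g : (gen_e i g : bool) = ~~ gen_f i g.
Proof. by rewrite /gen_e /gen_f; case: (epsP g.2) => - [? _ ->]; case: i. Qed.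

Lemma gen_eP g g' : gen_e i g = Some g' ->
  [/\ g' = (g.1, g.2 - 1), (eps g.2 == 1) = i & ~~ gen_e i g'].
Proof.
rewrite /gen_e; case: ifP => // /eqP hi [<-]; split=> //=.
case: ifP => // /eqP; rewrite -hi; case: (epsP g.2) => - [h -> ->]; rewrite /eps; lia.
Qed.

Lemma gen_fP g g' : gen_f i g = Some g' ->
  [/\ g' = (g.1, g.2 + 1), (eps g.2 == 0) = i & ~~ gen_f i g'].
Proof.
rewrite /gen_f; case: ifP => // /eqP hi [<-]; split=> //=.
case: ifP => // /eqP; rewrite -hi; case: (epsP g.2) => - [h -> ->]; rewrite /eps; lia.
Qed.

Lemma max_iter_gen_f g : max_iter (gen_f i) g = (gen_f i g : bool).
Proof.
case fg : (gen_f i g) => [g'|].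
  have [_ _ fg'] := gen_fP fg; apply: max_iterE; first by rewrite /iter_opt /= fg.
  by rewrite /iter_opt /= fg /=; case: (gen_f i g') fg'.
by apply: max_iterE => //; rewrite /iter_opt /= fg.
Qed.

(** Supplies the measure for [max_iter_eq0]: a factor that has been acted on admits [gen_e i] no
    longer. *)
Lemma word_e_count n w w' : E n w = Some w' ->
  (count (isSome \o gen_e i) w' < count (isSome \o gen_e i) w)%N.
Proof.
elim: n w w' => [|n IH] [|x w] w' //=; rewrite /tensor_e /=.
case: ifP => _.
  case ex : (gen_e i x) => [y|] //= [<-] /=.
  by have [_ _ ey] := gen_eP ex; rewrite (negPf ey).
by case Ew : (E n w) => [v|] //= [<-] /=; rewrite ltn_add2l; apply: IH.
Qed.

(** If [x] admits [gen_e i], it does not admit [gen_f i], and the rule only asks whether the tail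
    can be acted on. Otherwise [gen_f i] applies to [x] exactly once, and choosing [x] gives
    [None]. *)
Lemma word_e_cons n x w : E n.+1 (x :: w) =
  if gen_e i x is Some y then
    if E n w is Some w' then Some (x :: w') else Some (y :: w)
  else if (max_iter (E n) w <= 1)%N then None else omap (cons x) (E n w).
Proof.
rewrite /= /tensor_e /= max_iter_gen_f; have := gen_e_f x.
case ex : (gen_e i x) => [y|] /= /esym.
  move=> /negPf -> /=; rewrite leqn0 (max_iter_eq0 (@word_e_count n)).
  by case: (E n w).
by move/negbFE=> -> /=; case: ifP => // _; case: (E n w).
Qed.

Lemma word_f_cons n x w : F n.+1 (x :: w) =
  if gen_f i x is Some y then
    if E n w is None then Some (y :: w) else omap (cons x) (F n w)
  else omap (cons x) (F n w).
Proof.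
rewrite /= /tensor_f /= max_iter_gen_f.
case fx : (gen_f i x) => [y|] /=; last by case: (F n w).
rewrite ltnS leqn0 (max_iter_eq0 (@word_e_count n)).
by case: (E n w) => //= _; case: (F n w).
Qed.

Definition steps (op : gen -> option gen) (w w' : seq gen) : bool :=
  all2 (fun x y => (y == x) || (op x == Some y)) w w'.

Lemma stepsxx op w : steps op w w.
Proof. by rewrite /steps; elim: w => //= x w ->; rewrite eqxx. Qed.

Lemma word_e_steps n w w' : E n w = Some w' -> steps (gen_e i) w w'.
Proof.
elim: n w w' => [|n IH] [|x w] w' //; rewrite word_e_cons.
case ex : (gen_e i x) => [y|].
  case Ew : (E n w) => [v|] [<-] /=; first by rewrite eqxx (IH _ _ Ew).
  by rewrite ex eqxx orbT stepsxx.
by case: ifP => // _; case Ew : (E n w) => [v|] //= [<-] /=; rewrite eqxx (IH _ _ Ew).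
Qed.

Lemma word_f_steps n w w' : F n w = Some w' -> steps (gen_f i) w w'.
Proof.
elim: n w w' => [|n IH] [|x w] w' //; rewrite word_f_cons.
case fx : (gen_f i x) => [y|]; last first.
  by case Fw : (F n w) => [v|] //= [<-] /=; rewrite eqxx (IH _ _ Fw).
case Ew : (E n w) => [v|].
  by case Fw : (F n w) => [u|] //= [<-] /=; rewrite eqxx (IH _ _ Fw).
by case=> <- /=; rewrite fx eqxx orbT stepsxx.
Qed.

Lemma normal_cons2 x y w : normal [:: x, y & w] = (2 * H x.1 y.1 <= x.2 - y.2) && normal (y :: w).
Proof. by []. Qed.

(** If the head of the tail moves, the lowering bound seen by a left neighbour is 0, so the rule
    would have preferred that neighbour if it could move. *)
Lemma word_f_head n y t v : F n (y :: t) = Some v ->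
  (exists t', v = y :: t') \/
  [/\ exists v', v = (y.1, y.2 + 1) :: v', gen_f i y & E n (y :: t) = None].
Proof.
case: n => // n; rewrite word_f_cons word_e_cons; have := gen_e_f y.
case fy : (gen_f i y) => [z|] /=; last first.
  by case: (F n t) => //= t' _ [<-]; left; exists t'.
case: (gen_e i y) => // _; case Et : (E n t) => [u|].
  by case: (F n t) => //= t' [<-]; left; exists t'.
have [-> _ _] := gen_fP fy; case=> <-; right; split=> //; first by exists t.
rewrite (_ : max_iter _ _ = 0%N) //; apply/eqP; rewrite (max_iter_eq0 (@word_e_count n)).
by rewrite Et.
Qed.

Lemma word_e_head n y t v : E n (y :: t) = Some v ->
  exists2 y', v = y' :: behead v & y'.1 = y.1 /\ y'.2 <= y.2.
Proof.
case: n => // n; rewrite word_e_cons.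
case ey : (gen_e i y) => [z|].
  have [-> _ _] := gen_eP ey.
  by case: (E n t) => [u|] [<-] /=; [exists y|exists (y.1, y.2 - 1)] => //=; split=> //; lia.
by case: ifP => // _; case: (E n t) => //= t' [<-]; exists y.
Qed.

(* If the operator moves a factor [y] whose left neighbour [x] sits at the minimal
   distance, then [x] has the parity of [y] and the tensor rule would have chosen
   [x] instead. *)
Lemma word_f_normal n w w' : normal w -> F n w = Some w' -> normal w'.
Proof.
elim: n w w' => [|n IH] [|x w] w' // nw; rewrite word_f_cons.
have nt : normal w by case: w nw => //= ? ? /andP[].
(* The case in which the tail is acted on; the premise is what the tensor rule then says about
   [x]. *)
have caseF : (gen_f i x -> E n w) -> omap (cons x) (F n w) = Some w' -> normal w'.
  case Fw : (F n w) => [v|] //= hx [<-].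
  have nv := IH _ _ nt Fw; case: w nw Fw {nt IH} hx => [|y t]; first by case: n nv => //.
  move=> /[!normal_cons2] /andP[hxy _] /word_f_head[[t' et]|[[t' ev] fy Ey]] hx.
    by move: nv; rewrite et normal_cons2 hxy.
  move: nv; rewrite ev normal_cons2 => -> /=; rewrite andbT.
  have fx : ~~ gen_f i x by apply/negP => /hx; rewrite Ey.
  move: hxy; rewrite /H; move: fx fy; rewrite /gen_f.
  case: (epsP x.2) => - [? -> ->]; case: (epsP y.2) => - [? -> ->]; case: (i) => //=; case: ifP => _; lia.
case fx : (gen_f i x) caseF => [y|] caseF; last exact: caseF.
case Ew : (E n w) caseF => [v|] caseF; first exact: caseF.
case=> <-; have [-> _ _] := gen_fP fx; case: w nw {nt caseF Ew} => // z w.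
by rewrite !normal_cons2 /= => /andP[h ->]; rewrite andbT; lia.
Qed.

(** The critical case lowers [x] while [E] vanishes on the tail. Then [x] admits [gen_e i] and its
    neighbour does not, so their gap is odd and exceeds the even bound [2 * H]. The size bound
    ensures that [E] does not vanish merely because the recursion stops early. *)
Lemma word_e_normal n w w' : (size w <= n)%N -> normal w -> E n w = Some w' -> normal w'.
Proof.
elim: n w w' => [|n IH] [|x w] w' // sz nw; rewrite word_e_cons.
have nt : normal w by case: w nw {sz} => //= ? ? /andP[].
have caseE : omap (cons x) (E n w) = Some w' -> normal w'.
  case Ew : (E n w) => [v|] //= [<-].
  have nv := IH _ _ sz nt Ew; case: w nw Ew {nt IH sz} => [|y t]; first by case: n nv => //.
  move=> /[!normal_cons2] /andP[hxy _] /word_e_head[y' ev [ey1 ey2]].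
  move: nv; rewrite ev normal_cons2 => -> /=; rewrite andbT ey1; lia.
case ex : (gen_e i x) caseE => [y|] caseE; last by case: ifP.
case Ew : (E n w) caseE => [v|] caseE; first by move/caseE.
case=> <-; have [-> ei _] := gen_eP ex; case: w nw Ew sz {nt caseE} => // z w.
rewrite !normal_cons2 /=; case: n IH => // n _ /andP[h ->].
rewrite word_e_cons; have := gen_e_f z; case ez : (gen_e i z) => [u|].
  by case: (E n w).
move=> _ _ _; rewrite andbT; move: h ex ez; rewrite /H /gen_e.
case: (epsP x.2) => - [? -> ->]; case: (epsP z.2) => - [? -> ->]; case: (i) => //=; case: ifP => _; lia.
Qed.

End GenWord.

(** * Region functions and walls *)

Definition gwall (g : gen) : int := g.2 - (g.1 : bool)%:Z.

Definition sgn (b : bool) : int := (-1) ^+ b.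

Lemma sgnE b : sgn b = if b then -1 else 1.
Proof. by case: b. Qed.

Definition region_at (w : seq gen) (i : int) : int := \sum_(g <- w | gwall g < i) sgn g.1.

(** Normality as a partial order: generators at a common wall are comparable only if equal, so a
    normal word is determined by the multiplicities of its letters. *)
Definition wall_order : rel gen := fun x y => (gwall y < gwall x) || (x == y).

Lemma normal_sorted w : normal w = sorted wall_order w.
Proof.
apply: eq_sorted => -[p2 j2] [p1 j1]; rewrite /wall_order /gwall /H /= xpair_eqE.
by case: p2 p1 => -[] /=; lia.
Qed.

Lemma wall_order_trans : transitive wall_order.
Proof.
move=> y x z /orP[h|/eqP -> //] /orP[h'|/eqP <-]; rewrite /wall_order ?h //.
by rewrite (lt_trans h' h).
Qed.

Lemma wall_order_anti : antisymmetric wall_order.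
Proof.
move=> x y /andP[/orP[h|/eqP //] /orP[h'|/eqP //]].
by have := lt_trans h h'; rewrite ltxx.
Qed.

Definition coherent (w : seq gen) : Prop :=
  {in w &, forall x y, gwall x = gwall y -> x.1 = y.1}.

Lemma normal_coherent w : normal w -> coherent w.
Proof.
rewrite normal_sorted; elim: w => // x w IH /=; rewrite (path_sortedE wall_order_trans).
case/andP=> /allP hx /IH hw y z; rewrite !inE => /predU1P[->|hy] /predU1P[->|hz] //.
- by have /orP[|/eqP -> //] := hx _ hz; move=> + h; rewrite h ltxx.
- by have /orP[|/eqP -> //] := hx _ hy; move=> + h; rewrite h ltxx.
- exact: hw.
Qed.

Lemma normal_sorted_walls w : normal w -> sorted (fun a b : int => b <= a) (map gwall w).
Proof.
rewrite normal_sorted sorted_map; apply: sub_sorted => x y /orP[/ltW //|/eqP ->].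
exact: lexx.
Qed.

Lemma coherent_normal w :
  sorted (fun a b : int => b <= a) (map gwall w) -> coherent w -> normal w.
Proof.
rewrite normal_sorted; elim: w => // x w IH /=.
rewrite !path_sortedE; [|exact: wall_order_trans|by move=> a b c h1 h2; apply: le_trans h2 h1].
case/andP=> /allP hx hs hc; rewrite IH //; last first.
  by move=> y z hy hz; apply: hc; rewrite inE ?hy ?hz orbT.
rewrite andbT; apply/allP=> y hy; rewrite /wall_order.
have /hx := map_f gwall hy; rewrite le_eqVlt => /orP[/eqP e|->] //.
have e1 : y.1 = x.1 by apply: hc => //; rewrite inE ?eqxx ?hy ?orbT.
apply/orP; right; apply/eqP; move: e e1; case: x {hx hc} => p j; case: y {hy} => p' j'.
by rewrite /gwall /= => /[swap] -> /addIr ->.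
Qed.

Definition jump (w : seq gen) (l : int) : int := \sum_(g <- w | gwall g == l) sgn g.1.

Lemma region_at_jump w l : region_at w (l + 1) - region_at w l = jump w l.
Proof.
rewrite /region_at /jump; elim: w => [|g w IH]; rewrite ?big_nil ?subrr // !big_cons.
case: (ltrgtP (gwall g) l) => h.
- by rewrite (_ : gwall g < l + 1); [rewrite -IH; ring|lia].
- by rewrite (_ : (gwall g < l + 1) = false) //; lia.
- by rewrite h (_ : l < l + 1); [rewrite -IH; ring|lia].
Qed.

Lemma jump_count w l : jump w l =
  (count (fun g => (gwall g == l) && ~~ g.1) w)%:Z - (count (fun g => (gwall g == l) && g.1) w)%:Z.
Proof.
rewrite /jump; elim: w => [|g w IH]; rewrite ?big_nil ?subrr // !big_cons /= IH.
by case: (gwall g == l) => //=; rewrite sgnE; case: g.1 => /=; lia.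
Qed.

Lemma count_wall_split w l : count (fun g => gwall g == l) w =
  (count (fun g => (gwall g == l) && ~~ g.1) w + count (fun g => (gwall g == l) && g.1) w)%N.
Proof. by elim: w => //= g w ->; case: (gwall g == l); case: g.1; lia. Qed.

(** A sum of signs has absolute value equal to the number of its terms exactly when nothing
    cancels. *)
Lemma coherent_jump w : coherent w <->
  forall l, l \in map gwall w -> `|jump w l| = (count (fun g => gwall g == l) w)%:Z.
Proof.
split=> [hc l hl|hj x y hx hy hxy].
  rewrite count_wall_split jump_count.
  have [h1|h1] := boolP (has (fun g => (gwall g == l) && ~~ g.1) w); last first.
    by move: h1; rewrite has_count -eqn0Ngt => /eqP ->; lia.
  have [h2|h2] := boolP (has (fun g => (gwall g == l) && g.1) w); last first.
    by move: h2; rewrite has_count -eqn0Ngt => /eqP ->; lia.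
  case/hasP: h1 => x hx /andP[/eqP ex px]; case/hasP: h2 => y hy /andP[/eqP ey py].
  by have := hc _ _ hx hy (etrans ex (esym ey)); rewrite py (negPf px).
have := hj _ (map_f gwall hx); rewrite count_wall_split jump_count => h.
have h0 b z : z \in w -> gwall z = gwall x -> z.1 = b ->
    (0 < count (fun g => (gwall g == gwall x) && (if b then g.1 else ~~ g.1)) w)%N.
  by move=> hz ez ezb; rewrite -has_count; apply/hasP; exists z => //; rewrite ez eqxx -ezb; case: z.1.
case ex : (x.1); case ey : (y.1) => //.
- by have := h0 _ _ hx erefl ex; have := h0 _ _ hy (esym hxy) ey => /=; lia.
- by have := h0 _ _ hx erefl ex; have := h0 _ _ hy (esym hxy) ey => /=; lia.
Qed.

(** All steps at the wall of [g] agree, so the jump there is their number up to sign; the maximum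
    discards the case of opposite direction. *)
Lemma count_mem_jump w g : coherent w ->
  (count_mem g w)%:Z = Num.max 0 (sgn g.1 * jump w (gwall g)).
Proof.
move=> hc.
have e : count_mem g w = count (fun x => (gwall x == gwall g) && (if g.1 then x.1 else ~~ x.1)) w.
  apply: eq_count => -[p j] /=; case: g => p' j'; rewrite xpair_eqE /gwall /=.
  by case: p p' => -[] /=; lia.
have [hg|] := boolP (gwall g \in map gwall w); last first.
  move=> hg; rewrite e jump_count.
  have h0 (q : pred gen) : count (fun x => (gwall x == gwall g) && q x) w = 0%N.
    apply/eqP; rewrite eqn0Ngt -has_count; apply/hasPn => x hx.
    by apply: contra hg => /andP[/eqP <- _]; apply: map_f.
  by rewrite !h0 subrr mulr0 maxxx.
have /coherent_jump/(_ _ hg) := hc.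
rewrite count_wall_split jump_count e sgnE; case: g.1; lia.
Qed.

Lemma region_at_inj w w' : normal w -> normal w' -> region_at w =1 region_at w' -> w = w'.
Proof.
move=> n n' h; apply: (sorted_eq wall_order_trans wall_order_anti); rewrite -?normal_sorted //.
apply/allP=> g _ /=; rewrite -eqz_nat; apply/eqP.
rewrite !count_mem_jump; try exact: normal_coherent.
by rewrite -!region_at_jump !h.
Qed.

Lemma height_cons b p : height (b :: p) = sgn b + height p.
Proof. by rewrite /height big_cons. Qed.

Lemma regions_cons b p : regions (b :: p) = height (b :: p) :: regions p.
Proof.
rewrite /regions /= -[2%N]/(1 + 1)%N -[1%N in LHS]/(1 + 0)%N.
by rewrite iotaDl -map_comp.
Qed.

Lemma region_regions p r : (r <= size p)%N ->
  region (regions p) r = height (drop (size p - r) p).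
Proof.
move=> hr; have sz : size (regions p) = (size p).+1 by rewrite size_map size_iota.
rewrite /region nth_rev sz // subSS (nth_map 0%N); last by rewrite size_iota ltnS leq_subr.
by rewrite nth_iota // ltnS leq_subr.
Qed.

(** The walls descend along the list, so those below [i] form a suffix, whose height is the sum of
    their steps. *)
Lemma region_count w i : sorted (fun a b : int => b <= a) (map gwall w) ->
  region (regions (unzip1 w)) (count (fun l => l < i) (map gwall w)) = region_at w i.
Proof.
move=> hs; rewrite region_regions; last first.
  by rewrite size_map -(size_map gwall) count_size.
elim: w hs => [|g w IH]; first by rewrite /region_at /height !big_nil.
move=> /= hs; rewrite /region_at big_cons; case: ifP => hg.
  have -> : count (fun l => l < i) (map gwall w) = size w.
    rewrite -(size_map gwall); apply/eqP; rewrite -all_count.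
    have := order_path_min _ hs => /(_ (fun b a c h1 h2 => le_trans h2 h1)).
    by apply: sub_all => l hl; apply: le_lt_trans hg.
  rewrite /= size_map subnn drop0 height_cons; congr (_ + _).
  rewrite -/(region_at w i) -IH ?(path_sorted hs) // size_map.
  have -> : count (fun l => l < i) (map gwall w) = size w.
    rewrite -(size_map gwall); apply/eqP; rewrite -all_count.
    have := order_path_min _ hs => /(_ (fun b a c h1 h2 => le_trans h2 h1)).
    by apply: sub_all => l hl; apply: le_lt_trans hg.
  by rewrite subnn drop0.
rewrite add0n -/(region_at w i) -IH ?(path_sorted hs) //= subSn //.
by rewrite size_map -(size_map gwall) count_size.
Qed.

(** Inverse of [regions]: the bit is 1 where the region drops from right to left. *)
Fixpoint wbits (ms : seq int) : seq bool :=
  if ms is a :: ms' then (if ms' is b :: _ then (a < b) :: wbits ms' else [::]) else [::].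

Lemma wbitsK ms : ms != [::] -> last 0 ms = 0 ->
  sorted (fun a b : int => `|a - b| == 1) ms -> regions (wbits ms) = ms.
Proof.
elim: ms => // a [|b ms] IH _ hl hs; first by rewrite /regions /= /height big_nil [a]hl.
case/andP: hs => hab hs; rewrite [wbits _]/= regions_cons IH //; congr (_ :: _).
have e : height (wbits (b :: ms)) = b.
  have := IH isT hl hs; move: (wbits _) => p; rewrite /regions /= drop0 => -[//].
by rewrite height_cons e sgnE; case: ifP; lia.
Qed.

(** * Reduced wall data and coherent words *)

Section Reduced.
Variable w : seq gen.
Hypothesis sw : sorted (fun a b : int => b <= a) (map gwall w).
Let ls := map gwall w.
Let ms := regions (unzip1 w).
Let cnt (l : int) := count (fun x : int => x < l) ls.

Let sr : sorted <=%O (rev ls).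
Proof. by rewrite rev_sorted. Qed.

Let cntE l : cnt l = count (< l) (rev ls).
Proof. by rewrite count_rev. Qed.

Lemma wall_lt l s : (0 < s <= cnt l)%N -> wall ls s < l.
Proof.
case: s => // s /= hs; apply: nth_count_lt => //.
by rewrite -cntE.
Qed.

Lemma wall_ge l s : (cnt l < s <= size ls)%N -> l <= wall ls s.
Proof.
case: s => // s /= hs; apply: nth_count_ge => //.
by rewrite -cntE size_rev.
Qed.

Lemma cnt_eq l s : (s <= size ls)%N -> (s = 0%N \/ wall ls s < l) ->
  (s = size ls \/ l <= wall ls s.+1) -> cnt l = s.
Proof.
move=> hs h1 h2; have hc : (cnt l <= size ls)%N by exact: count_size.
case: (ltngtP (cnt l) s) => // h.
  case: h1 => [h1|]; first by rewrite h1 in h.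
  by rewrite ltNge wall_ge // h.
case: h2 => [h2|]; first by move: h; rewrite h2 ltnNge hc.
by rewrite leNgt wall_lt.
Qed.

Lemma cntS l : cnt (l + 1) = (cnt l + count (fun g => gwall g == l) w)%N.
Proof.
rewrite /cnt !count_map /ls; elim: w => //= g v ->.
case: (ltrgtP (gwall g) l) => h; lia.
Qed.

Lemma jump_region l : jump w l = region ms (cnt (l + 1)) - region ms (cnt l).
Proof. by rewrite !region_count // region_at_jump. Qed.

(** The walls at [l] carry the indices [cnt l + 1] to [cnt (l + 1)], so the difference of regions in
    [reduced] is [jump w l], and the condition becomes that of [coherent_jump]. *)
Lemma reduced_coherent : reduced ls ms <-> coherent w.
Proof.
rewrite coherent_jump; split=> [hr l hl|hj s s' s0 s'0 hss hend hcl hbeg].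
  set c := count _ w.
  have c0 : (0 < c)%N.
    by rewrite -has_count; case/mapP: hl => g hg ->; apply/hasP; exists g => /=.
  have hS := cntS l; rewrite -/c in hS.
  have hsz : (cnt (l + 1)%R <= size ls)%N by exact: count_size.
  have hw t : (cnt l < t <= cnt l + c)%N -> wall ls t = l.
    move=> ht; apply/eqP; rewrite eq_le; apply/andP; split.
      by rewrite -ltzD1; apply: wall_lt; rewrite hS; lia.
    by apply: wall_ge; rewrite hS in hsz; lia.
  have hsz' : (cnt l + c <= size ls)%N by rewrite -hS.
  rewrite jump_region -(hr (cnt l).+1 c) //.
  - by rewrite hS.
  - have [h|h] := eqVneq (cnt l + c)%N (size ls); [by left; rewrite -h|right].
    have -> : ((cnt l).+1 + c).-1 = (cnt l + c)%N by [].
    rewrite hw; last by lia.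
    by rewrite -lezD1; apply: wall_ge; rewrite hS; lia.
  - by move=> t ht; rewrite !hw //; lia.
  - case: (posnP (cnt l)) => h; [by left; rewrite h|right].
    by rewrite -[X in X < _]/(wall ls (cnt l)) (hw (cnt l).+1); [apply: wall_lt|]; lia.
set l := wall ls s.
have {}hend : (s + s')%N = (size ls).+1 \/ wall ls (s + s').-1 < wall ls (s + s')%N := hend.
have e1 : cnt l = s.-1.
  apply: cnt_eq; [lia| |right; rewrite prednK //].
  by case: hbeg => [->|]; [left|right].
have e2 : cnt (l + 1) = (s + s').-1.
  apply: cnt_eq; [lia|right|].
    by rewrite ltzD1 hcl //; lia.
  case: hend => [h|h]; [by left; rewrite h|right].
  by rewrite prednK ?addn_gt0 ?s0 // lezD1 /l; rewrite hcl // in h; lia.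
have hs1 : (s.-1 < size ls)%N by lia.
have hl : l \in ls by rewrite -mem_rev /l /wall; apply: mem_nth; rewrite size_rev.
have := cntS l; rewrite e1 e2 => hc.
by rewrite -e1 -e2 -jump_region hj //; congr Posz; lia.
Qed.

End Reduced.

Lemma normal_reduced w : normal w -> reduced (map gwall w) (regions (unzip1 w)).
Proof.
by move=> n; apply/reduced_coherent; [apply: normal_sorted_walls|apply: normal_coherent].
Qed.

(** The map is the identity for even [i] and the reflection of m to k - m for odd [i]. *)
Lemma pbarK k i : cancel (fun m => pbar k m i) (fun x => pbar k x i).
Proof. by move=> m; rewrite /pbar; case: (epsP i) => - [? _ ->]; lia. Qed.

Definition of_walls (ls ms : seq int) : seq gen :=
  [seq (x.1, x.2 + x.1%:Z) | x : bool * int <- zip (wbits ms) ls].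

Lemma size_wbits ms : size (wbits ms) = (size ms).-1.
Proof. by elim: ms => // a [|b ms] //= ->. Qed.

Lemma of_wallsE k m ls ms : region_seq k m 0 (size ls) ms ->
  [/\ map gwall (of_walls ls ms) = ls, unzip1 (of_walls ls ms) = wbits ms
    & regions (wbits ms) = ms].
Proof.
case/and5P=> /eqP sz _ /eqP hl _ hs.
have szb : size (wbits ms) = size ls by rewrite size_wbits sz.
split.
- rewrite /of_walls -map_comp -[RHS](@unzip2_zip _ _ (wbits ms)) ?szb //.
  by apply: eq_map => x /=; rewrite /gwall /= addrK.
- by rewrite /of_walls /unzip1 -map_comp -[RHS](@unzip1_zip _ _ _ ls) ?szb.
- by apply: wbitsK => //; case: ms sz {hl hs szb}.
Qed.

Lemma wall_fun_region_at k w i : normal w ->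
  wall_fun k (map gwall w) (regions (unzip1 w)) i = pbar k (region_at w i) i.
Proof. by move=> n; rewrite /wall_fun region_count // normal_sorted_walls. Qed.

(** The data come from the word [of_walls ls ms], which is normal because reduced data are coherent;
    it has the region function of [w], hence equals [w]. *)
Lemma wall_data_uniq k m p w ls ms : normal w ->
  (forall i, p i = pbar k (region_at w i) i) ->
  wall_data k m 0 p (ls, ms) -> (ls, ms) = (map gwall w, regions (unzip1 w)).
Proof.
move=> n hp [/= hs hreg hred hpe].
have [hw hb hm] := of_wallsE hreg.
set v := of_walls ls ms in hw hb.
have nv : normal v.
  apply: coherent_normal; first by rewrite hw.
  by apply/reduced_coherent; rewrite hw ?hb ?hm.
suff <- : v = w by rewrite hw hb hm.
apply: region_at_inj => // i; have := hpe i; rewrite hp -{1}hw -hm -hb wall_fun_region_at //.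
by move/(can_inj (pbarK k i)).
Qed.

(** * The bijection and the crystal operators *)

Lemma region_at_cat v w i : region_at (v ++ w) i = region_at v i + region_at w i.
Proof. by rewrite /region_at big_cat. Qed.

Lemma region_at_nseq c g i : region_at (nseq c g) i = if gwall g < i then c%:Z * sgn g.1 else 0.
Proof.
rewrite /region_at; elim: c => [|c IH] /=; first by rewrite big_nil mul0r if_same.
by rewrite big_cons IH; case: (_ < i); rewrite // intS; ring.
Qed.

Lemma height_region_at w i : all (fun g => gwall g < i) w -> height (unzip1 w) = region_at w i.
Proof.
rewrite /height /region_at /unzip1 big_map => /allP h.
by rewrite big_seq [RHS]big_seq_cond; apply: eq_bigl => g; case: (boolP (g \in w)) => //= /h.
Qed.

Lemma height_nseq_cat c b p : height (nseq c b ++ p) = c%:Z * sgn b + height p.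
Proof.
elim: c => [|c IH] /=; first by rewrite mul0r add0r.
by rewrite height_cons IH intS; ring.
Qed.

Definition bounded k (p : seq bool) := all (fun m : int => 0 <= m <= k%:Z) (regions p).

(** Equal steps are monotone, so the intermediate regions lie between two admissible values. *)
Lemma bounded_nseq_cat k c b p : bounded k p ->
  0 <= height (nseq c b ++ p) <= k%:Z -> bounded k (nseq c b ++ p).
Proof.
move=> hp; have h0 : 0 <= height p <= k%:Z.
  by case/andP: hp; rewrite drop0.
elim: c => //= c IH h; rewrite /bounded regions_cons /= h /=; apply: IH.
by move: h h0; rewrite height_cons height_nseq_cat sgnE; case: b; lia.
Qed.

Lemma normal_nseq_cat c g w : normal w -> all (fun x => gwall x < gwall g) w ->
  normal (nseq c g ++ w).
Proof.
rewrite !normal_sorted => n h; elim: c => //= c IH.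
rewrite path_sortedE ?IH ?andbT; last exact: wall_order_trans.
rewrite all_cat all_nseq (_ : wall_order g g) ?orbT /=; last by rewrite /wall_order eqxx orbT.
by apply: sub_all h => x hx; rewrite /wall_order hx.
Qed.

(** Scan to the right from [a], prepending at each position L as many copies of one generator with
    wall L as the jump of [R] there requires. The minimum freezes [R] beyond the part scanned. *)
Lemma word_exists (k : nat) (R : int -> int) (a : int) (n : nat) :
  (forall i, 0 <= R i <= k%:Z) -> (forall i, i <= a -> R i = 0) ->
  exists w, [/\ normal w, all (fun g => gwall g < a + n%:Z) w,
    forall i, region_at w i = R (Num.min i (a + n%:Z)) & bounded k (unzip1 w)].
Proof.
move=> hR ha; elim: n => [|n [w [nw hw hf hb]]].
  exists [::]; split=> //.
    by move=> i; rewrite /region_at big_nil ha // ge_min addr0 lexx orbT.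
  by rewrite /bounded /regions /= /height big_nil lexx.
set L := a + n%:Z in hw hf.
have -> : a + n.+1%:Z = L + 1 by rewrite /L; lia.
pose D := R (L + 1) - R L; pose g : gen := (D < 0, L + (D < 0)%R%:Z).
have gL : gwall g = L by rewrite /gwall addrK.
have hD : `|D|%N%:Z * sgn (D < 0) = D by rewrite sgnE; case: ifP; lia.
exists (nseq `|D|%N g ++ w); split.
- by apply: normal_nseq_cat; rewrite ?gL.
- rewrite all_cat all_nseq gL ltrDl ltr01 orbT /=.
  by apply: sub_all hw => x /lt_trans; apply; rewrite ltrDl.
- move=> i; rewrite region_at_cat region_at_nseq gL hD hf; case: ltP => h.
    by rewrite (min_idPr _) ?lezD1 // /D subrK.
  by rewrite (min_idPl _) ?add0r //; lia.
- rewrite /unzip1 map_cat map_nseq; apply: bounded_nseq_cat => //.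
  rewrite height_nseq_cat hD (height_region_at hw) hf minxx /D subrK; exact: hR.
Qed.

Lemma bounded_respath k l p : bounded k p -> height p = l -> respath k l p.
Proof.
move=> hb hp; rewrite /respath hp eqxx andbT; move: hb; rewrite /bounded /regions.
by rewrite all_map -addn1 iotaD all_cat => /andP[].
Qed.

Section Theta.
Variables (k l : nat).

Lemma theta_val (x : res_crystal k l) i :
  val (theta x) i = pbar k (region_at (val (tagged x)) i) i.
Proof.
case: x => p b; rewrite /theta /=; have /andP[/eqP hb nb] := valP b.
by have := wall_fun_region_at k i nb; rewrite hb.
Qed.

Lemma get_walls_theta (x : res_crystal k l) :
  get_walls (theta x) = (map gwall (val (tagged x)), regions (val (tag x))).
Proof.
have hv := theta_val x; case: x hv => p b hv; have /andP[/eqP hb nb] := valP b.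
have hw : wall_data k l 0 (val (theta (existT _ p b : res_crystal k l)))
   (map gwall (val b), regions (unzip1 (val b))).
  split=> //=; [exact: normal_sorted_walls|rewrite hb|exact: normal_reduced|by rewrite hb].
  exact: nmonomial_region_seq.
apply: xget_unique; first by move: hw; rewrite hb.
by move=> -[ls ms] hd /=; have := wall_data_uniq nb hv hd; rewrite hb.
Qed.

Lemma theta_inj : injective (@theta k l).
Proof.
move=> x y e; have {e}: region_at (val (tagged x)) =1 region_at (val (tagged y)).
  by move=> i; apply: (can_inj (pbarK k i)); rewrite -!theta_val e.
case: x y => [p b] [p' b'] /= h.
have /andP[/eqP hb nb] := valP b; have /andP[/eqP hb' nb'] := valP b'.
have ew := region_at_inj nb nb' h.
have ep : p = p' by apply: val_inj; rewrite -hb -hb' ew.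
by case: p' / ep b' ew {h hb' nb'} => b' /val_inj ->.
Qed.

Lemma theta_surj (q : path_crystal k l 0) : exists x, @theta k l x = q.
Proof.
have /asboolP[hq [N hN]] := valP q.
pose R i := pbar k (val q i) i.
have Rq i : val q i = pbar k (R i) i by rewrite /R (pbarK k i).
have Rinf i : N <= `|i| -> R i = if 1 <= i then l%:Z else 0.
  by move=> /hN; rewrite /R => ->; rewrite /pbar2; case: ifP => _; rewrite (pbarK k i).
have hR i : 0 <= R i <= k%:Z.
  by have := hq i; rewrite /R /pbar; case: (epsP i) => - [? _ ->]; lia.
pose M := `|N|%N.
(* The scan ends at M + 1, which is at least 1 even if M = 0, so the region there is already [l]. *)
have [i hi|w [nw hw hf hb]] := @word_exists k R (- M%:Z) (M + M + 1)%N hR.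
  by rewrite Rinf /M; [case: ifP|]; lia.
have hf' i : region_at w i = R i.
  rewrite hf; case: (leP i) => // hi.
  by rewrite !Rinf /M; [case: ifP; case: ifP| |]; lia.
have hl : height (unzip1 w) = l%:Z.
  by rewrite (height_region_at hw) hf' Rinf /M; [case: ifP|]; lia.
have hp := bounded_respath hb hl.
have hn : (unzip1 w == unzip1 w) && normal w by rewrite eqxx.
exists (existT _ (exist _ (unzip1 w) hp) (exist _ w hn)).
by apply/val_inj/funext => i; rewrite theta_val /= hf' Rq.
Qed.

Lemma theta_bij : bijective (@theta k l).
Proof.
have h := fun q => cid (theta_surj q).
exists (fun q => projT1 (h q)) => [x|q]; last exact: (projT2 (h q)).
by apply: theta_inj; apply: (projT2 (h (theta x))).
Qed.

(** * Signs of walls and the crystal operators *)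

Definition gsign (g : gen) : bool := eps g.2 == 1.

(** At a wall l the number p(l) + p(l + 1) - k is the jump of the region, negated when l is even.
    The direction of the jump and the parity of l combine to the parity of the index. *)
Lemma signs_theta (x : res_crystal k l) :
  signs k (val (theta x)) (map gwall (val (tagged x))) = map gsign (val (tagged x)).
Proof.
rewrite /signs -map_comp; apply/eq_in_map => g hg.
rewrite -[LHS]/(k%:Z < val (theta x) (gwall g) + val (theta x) (gwall g + 1)) !theta_val; set w := val _ in hg *.
have /andP[_ nw] := valP (tagged x).
have c0 : (0 < count_mem g w)%N by rewrite -has_count has_pred1.
have := count_mem_jump g (normal_coherent nw); rewrite -/w -region_at_jump => hj.
have {hj c0} : 0 < sgn g.1 * (region_at w (gwall g + 1) - region_at w (gwall g)).
  by move: c0; rewrite -ltz_nat hj lt_max ltxx.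
move: (region_at w _) (region_at w _) => u v; rewrite /gsign /pbar sgnE.
case: g {hg} => p j; rewrite /gwall /=.
rewrite epsS epsB; case: (epsP j) => - [h _ ->]; case: p => /= hj; apply/idP/idP; lia.
Qed.

Lemma b1_e_gsign i g : b1_e i (gsign g) = omap gsign (gen_e i g).
Proof.
rewrite /b1_e /gen_e /gsign; case: ifP => //= h; congr Some.
by case: (epsP g.2) => - [? -> ->]; rewrite /eps; apply/idP/idP; lia.
Qed.

Lemma b1_f_gsign i g : b1_f i (gsign g) = omap gsign (gen_f i g).
Proof.
rewrite /b1_f /gen_f /gsign; case: (epsP g.2) => - [? -> ->]; case: i => //=; congr Some;
  by rewrite /eps; apply/idP/idP; lia.
Qed.

Lemma steps_unzip1 op w w' : (forall g g', op g = Some g' -> g'.1 = g.1) ->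
  steps op w w' -> unzip1 w' = unzip1 w.
Proof.
move=> hop; elim: w w' => [|g w IH] [|g' w'] //= /andP[h /IH ->].
by congr (_ :: _); case/orP: h => /eqP; [move=> ->|exact: hop].
Qed.

(** A factor changes its sign exactly when it moves, so comparing signs locates the moved wall. *)
Lemma steps_move (d : int) op w w' :
  (forall g g', op g = Some g' -> gwall g' = gwall g + d /\ gsign g' = ~~ gsign g) ->
  steps op w w' -> move d (map gwall w) (map gsign w) (map gsign w') = map gwall w'.
Proof.
move=> hop; elim: w w' => [|g w IH] [|g' w'] //= /andP[h /IH <-].
congr (_ :: _); case/orP: h => /eqP; first by move=> ->; rewrite eqxx.
by case/hop => -> ->; case: (gsign g).
Qed.

Lemma theta_act (op : gen -> option gen) (d : int)
    (word : seq gen -> option (seq gen)) (sword : seq bool -> option (seq bool))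
    (p : {p : seq bool | respath k l p}) (b : B (val p)) :
  (forall g g', op g = Some g' ->
     [/\ g'.1 = g.1, gwall g' = gwall g + d & gsign g' = ~~ gsign g]) ->
  (forall w, sword (map gsign w) = omap (map gsign) (word w)) ->
  (forall w w', word w = Some w' -> steps op w w') ->
  (forall w w', normal w -> word w = Some w' -> normal w') ->
  path_act sword d (theta (existT _ p b : res_crystal k l)) =
  omap (@theta k l) (omap (fun b' => existT _ p b')
    (obind (normal_form b) (word (val b)))).
Proof.
move=> hop hs hst hn; rewrite /path_act get_walls_theta signs_theta hs /=.
have /andP[/eqP hb nb] := valP b.
case hw : (word (val b)) => [w|] //=.
have hst' := hst _ _ hw; have nw := hn _ _ nb hw.
have hp : unzip1 w = val p.
  by rewrite (steps_unzip1 _ hst') ?hb // => g g' /hop[].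
have hpn : (unzip1 w == val p) && normal w by rewrite hp eqxx.
rewrite (steps_move (d := d) _ hst'); last by move=> g g' /hop[].
rewrite (normal_formE b hpn) /=.
(* The moved wall function is by conversion the value of [theta] at the new word, so [insub]
   succeeds. *)
set t := theta _; rewrite -[X in insub X]/(val t); exact: valK.
Qed.

Lemma theta_e i (x : res_crystal k l) : ce i (theta x) = omap (@theta k l) (ce i x).
Proof.
case: x => p b; apply: (@theta_act (gen_e i)).
- move=> g g' ge; have := gen_eP ge; have := b1_e_gsign i g.
  rewrite ge /= /b1_e; case: ifP => // _ [<-] [-> _ _]; split=> //.
  by rewrite /gwall /=; lia.
- move=> w; rewrite /word_e size_map; apply: word_e_rec_map.
  + exact: b1_e_gsign.
  + exact: b1_f_gsign.
- by move=> w w'; apply: word_e_steps.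
- by move=> w w'; apply: word_e_normal.
Qed.

Lemma theta_f i (x : res_crystal k l) : cf i (theta x) = omap (@theta k l) (cf i x).
Proof.
case: x => p b; apply: (@theta_act (gen_f i)).
- move=> g g' gf; have := gen_fP gf; have := b1_f_gsign i g.
  rewrite gf /= /b1_f; case: ifP => // _ [<-] [-> _ _]; split=> //.
  by rewrite /gwall /=; lia.
- move=> w; rewrite /word_f size_map; apply: word_f_rec_map.
  + exact: b1_e_gsign.
  + exact: b1_f_gsign.
- by move=> w w'; apply: word_f_steps.
- by move=> w w'; apply: word_f_normal.
Qed.

End Theta.

(** * Weights *)

(** Outside the window from -N to N - 1 all differences vanish; inside it each [G g] telescopes from
    0 to [c g]. *)
Lemma fsum_telescope (F : int -> int) (w : seq gen) (G : gen -> int -> int)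
    (c : gen -> int) (N : nat) :
  (forall i, F i = \sum_(g <- w) (G g (i + 1) - G g i)) ->
  (forall g i, g \in w -> i <= - N%:Z -> G g i = 0) ->
  (forall g i, g \in w -> N%:Z <= i -> G g i = c g) ->
  \sum_(i \in [set: int]) F i = \sum_(g <- w) c g.
Proof.
move=> hF hlo hhi; pose r := [seq n%:Z - N%:Z | n <- iota 0 (N + N)].
rewrite (fsbigE r).
- rewrite /r big_map big_mkcond /=.
  under eq_bigr => n _ do rewrite in_setT /= hF.
  rewrite exchange_big big_seq [RHS]big_seq; apply: eq_bigr => g hg.
  rewrite -[X in iota 0 X]subn0 -/(index_iota 0 (N + N)).
  rewrite (@telescope_sumr_eq _ _ _ (fun n : nat => G g (n%:Z - N%:Z))) //.
    rewrite (hhi g) //; last by lia.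
    by rewrite (hlo g) ?subr0 //; lia.
  by move=> n _; congr (G g _ - _); rewrite intS; ring.
- by rewrite map_inj_uniq ?iota_uniq // => a b /addIr [].
- by move=> i.
- move=> i _ hir; rewrite hF big_seq big1 // => g hg.
  have [hi|hi] := lerP (N%:Z) i.
    by rewrite !(hhi g) ?subrr //; lia.
  have hi' : i < - N%:Z.
    rewrite ltNge; apply: contra hir => hi'; apply/mapP.
    by exists (absz (i + N%:Z)); [rewrite mem_iota|]; lia.
  by rewrite !(hlo g) ?subrr //; lia.
Qed.

Definition ind (b : bool) : int := b%:Z.

(* The telescoped form of [v i * ([0 < i] - [l < i])] when [u (i + 1) - u i = v i]. *)
Definition parts (u : int -> int) (l i : int) : int :=
  ind (0 < i) * (u i - u 1) - ind (l < i) * (u i - u (l + 1)).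

Lemma partsE u l i : parts u l (i + 1) - parts u l i =
  (u (i + 1) - u i) * (ind (0 < i) - ind (l < i)).
Proof.
(* The indicators differ only at [i = x], where the other factor is 0. *)
have h0 x : ind (x < i + 1) * (u (i + 1) - u (x + 1)) =
            ind (x < i) * (u (i + 1) - u (x + 1)).
  have [h|h|h] := ltrgtP x i.
  - by have -> : x < i + 1 by lia.
  - by have -> : (x < i + 1) = false by lia.
  - by rewrite h subrr !mulr0.
by have h1 := h0 0; rewrite add0r in h1; rewrite /parts h1 (h0 l); ring.
Qed.

Lemma parts_lo u l i : i <= 0 -> i <= l -> parts u l i = 0.
Proof. by rewrite /parts !leNgt => /negPf -> /negPf ->; rewrite !mul0r subrr. Qed.

Lemma parts_hi u l i : 0 < i -> l < i -> parts u l i = u (l + 1) - u 1.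
Proof. by rewrite /parts => -> ->; rewrite /ind !mul1r; ring. Qed.

(* An antiderivative of [i * (-1) ^ i]; one of [(-1) ^ i] is [eps]. *)
Definition half_sum (i : int) : int := (2 * eps i - 1) * (i %/ 2)%Z.

Lemma half_sumS i : half_sum (i + 1) - half_sum i = i * (1 - 2 * eps i).
Proof. by rewrite /half_sum epsS; case: (epsP i) => - [h -> ->]; lia. Qed.

Lemma eps_diff i : eps (i + 1) - eps i = 1 - 2 * eps i.
Proof. by rewrite epsS; ring. Qed.

(* The part of Htilde that is not linear in the regions, see [excess_jump]: on a
   coherent word only steps of one sign occur at [i]. *)
Definition excess (w : seq gen) (i : int) : int :=
  \sum_(g <- w) ind (gwall g == i) * ind (g.1 != (eps i == 1)).

(** [Htilde k a b] equals - b + max(0, a + b - k), and here a + b - k is the difference of the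
    regions with a sign given by the parity of [i]. *)
Lemma Htilde_pbar k R R' i : Htilde k (pbar k R' (i + 1)) (pbar k R i) =
  - (1 - 2 * eps i) * R - k%:Z * eps i + Num.max 0 ((1 - 2 * eps i) * (R - R')).
Proof.
by rewrite /Htilde /pbar epsS; case: (epsP i) => - [h _ ->]; case: ifP; lia.
Qed.

(** Only one generator, [g0], has wall [i] and the upper index counted by [excess], so its
    multiplicity is read off from the jump. *)
Lemma excess_jump w i : coherent w ->
  excess w i = Num.max 0 ((1 - 2 * eps i) * - jump w i).
Proof.
move=> hc; pose p := eps i == 0; pose g0 : gen := (p, i + p%:Z).
have -> : excess w i = (count_mem g0 w)%:Z.
  rewrite /excess; elim: w {hc} => [|g w IH]; first by rewrite big_nil.
  rewrite big_cons IH /= PoszD; congr (_ + _); rewrite /ind -PoszM mulnb; congr (nat_of_bool _)%:Z.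
  rewrite /g0 /p /gwall; case: g => q j; rewrite xpair_eqE /=.
  by case: (epsP i) => - [h _ ->]; case: q => /=; lia.
rewrite count_mem_jump //= (_ : gwall g0 = i); last by rewrite /gwall addrK.
congr (Num.max _ _); rewrite sgnE /p.
by case: (epsP i) => - [h _ ->] /=; ring.
Qed.

Section ThetaWt.
Variables (k l : nat) (w : seq gen).
Hypotheses (nw : normal w) (hl : height (unzip1 w) = l%:Z).
Notation p := (fun i => pbar k (region_at w i) i).
Notation N := (\sum_(g <- w) absz (gwall g))%N.+1.

Let wall_bound g : g \in w -> `|gwall g| < N%:Z.
Proof.
move=> hg; suff : (absz (gwall g) < N)%N by lia.
by rewrite ltnS (big_rem g hg) leq_addr.
Qed.

Let base (i : int) : (if 1 <= i then l%:Z else 0) = \sum_(g <- w) sgn g.1 * ind (0 < i).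
Proof.
rewrite -mulr_suml -hl /height big_map gtz0_ge1.
by case: (1 <= i); rewrite ?mulr1 ?mulr0.
Qed.

Let region_atE i : region_at w i = \sum_(g <- w) sgn g.1 * ind (gwall g < i).
Proof.
by rewrite /region_at big_mkcond; apply: eq_bigr => g _; case: ifP; rewrite ?mulr1 ?mulr0.
Qed.

Let pbar2E i : pbar2 k l 0 i = pbar k (if 1 <= i then l%:Z else 0) i.
Proof. by rewrite /pbar2; case: ifP. Qed.

(** Summation by parts: since [w] has height [l], the ground path is obtained by moving every wall
    of [w] to 0. *)
Let diffE (u : int -> int) (i : int) :
  (u (i + 1) - u i) * ((if 1 <= i then l%:Z else 0) - region_at w i) =
  \sum_(g <- w) (sgn g.1 * parts u (gwall g) (i + 1) - sgn g.1 * parts u (gwall g) i).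
Proof.
rewrite base region_atE -sumrB mulr_sumr; apply: eq_bigr => g _.
by rewrite -[RHS]mulrBr partsE; ring.
Qed.

Lemma path_sE : path_s k l 0 p = \sum_(g <- w) sgn g.1 * (eps (gwall g + 1) - 1).
Proof.
apply: (@fsum_telescope _ _ (fun g i => sgn g.1 * parts eps (gwall g) i) _ N) => [i|g i|g i].
- by rewrite pbar2E -diffE eps_diff /pbar; ring.
- by move=> /wall_bound hg hi; rewrite parts_lo ?mulr0 //; lia.
- by move=> /wall_bound hg hi; rewrite parts_hi //; lia.
Qed.

(** The linear part of [Htilde] is summed by parts with [half_sum], which vanishes at 1; the excess
    contributes at the wall itself. *)
Lemma path_hE : path_h k l 0 p = \sum_(g <- w)
  (sgn g.1 * half_sum (gwall g + 1) + gwall g * ind (g.1 != (eps (gwall g) == 1))).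
Proof.
pose X g := gwall g * ind (g.1 != (eps (gwall g) == 1)).
apply: (@fsum_telescope _ _ (fun g i => sgn g.1 * parts half_sum (gwall g) i
   + ind (gwall g < i) * X g) _ N) => [i|g i|g i].
(* The ground path jumps only at the even position 0, and upwards, so it has no excess. *)
- have base0 : Num.max 0 ((1 - 2 * eps i) * ((if 1 <= i then l%:Z else 0) -
      (if 1 <= i + 1 then l%:Z else 0))) = 0 :> int.
    case: (ltrgtP i 0) => h.
    + by rewrite !ifF; [lia|lia|lia].
    + by rewrite !ifT; [lia|lia|lia].
    + by rewrite h /eps /=; lia.
  rewrite !pbar2E !Htilde_pbar base0 -[region_at w i - _]opprB region_at_jump -excess_jump; last exact: normal_coherent.
  under [RHS]eq_bigr => g _ do rewrite opprD addrACA.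
  rewrite big_split /= -diffE half_sumS.
  have -> : \sum_(g <- w) (ind (gwall g < i + 1) * X g - ind (gwall g < i) * X g) = i * excess w i.
    rewrite /excess mulr_sumr; apply: eq_bigr => g _; rewrite -mulrBl.
    have -> : ind (gwall g < i + 1) - ind (gwall g < i) = ind (gwall g == i).
      by rewrite /ind; case: (ltrgtP (gwall g) i); lia.
    rewrite /X; case: eqP => [->|_]; first by rewrite -[ind true]/(1 : int) !mul1r.
    by rewrite -[ind false]/(0 : int) !mul0r mulr0.
  ring.
- move=> /wall_bound hg hi; rewrite parts_lo ?mulr0; [|lia|lia].
  by rewrite (_ : (gwall g < i) = false) ?mul0r //; lia.
- move=> /wall_bound hg hi; rewrite parts_hi; [|lia|lia].
  by rewrite (_ : gwall g < i) ?mul1r ?subr0 //; lia.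
Qed.

(** Writing [l] as the height of [w] distributes m - m' over the generators; the weights then agree
    factor by factor. *)
Lemma path_wtE : path_wt k l 0 p = \sum_(g <- w) gen_wt g.
Proof.
rewrite /path_wt path_sE path_hE /gen_wt [RHS]sumrB -!mulrz_sumr.
congr (_ *~ _ - _ *~ _).
  rewrite subr0 -hl /height big_map mulr_sumr -big_split /=; apply: eq_bigr => g _.
  rewrite -/(sgn g.1) /gwall epsS epsB sgnE.
  by case: g => -[] j /=; case: (epsP j) => - [h _ ->] /=; lia.
apply: eq_bigr => g _; rewrite /half_sum /gwall !epsS !epsB sgnE /ind.
by case: g => -[] j /=; case: (epsP j) => - [h -> ->] /=; lia.
Qed.

End ThetaWt.

Lemma theta_wt k l (x : res_crystal k (Posz l)) : wt (theta x) = wt x.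
Proof.
have hv : val (theta x) = fun i => pbar k (region_at (val (tagged x)) i) i.
  by apply/funext => i; apply: theta_val.
rewrite -[LHS]/(path_wt k l 0 (val (theta x))) hv.
have /andP[/eqP hb nb] := valP (tagged x).
rewrite path_wtE // hb; by have /andP[_ /eqP] := valP (tag x).
Qed.

Theorem theorem3 (k l : nat) (hk : (1 <= k)%N) (hl : (l <= k)%N) :
  crystal_iso (@theta k (Posz l)).
Proof.
split; [exact: theta_bij|exact: theta_e|exact: theta_f|exact: theta_wt].
Qed.
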